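(* Let $r\ge3$ be odd, $\zeta=e^{2\pi i/r}$, and let $\rho_2^{\mathfrak u_\zeta}(\tau_\gamma):\mathrm{ad}^{\otimes2}\to\mathrm{ad}^{\otimes2}$ be the linear map $x\otimes y\mapsto xS(v^{-1}_{(1)})\otimes v^{-1}_{(2)}y$ giving the quantum action of the Dehn twist $\tau_\gamma$, where $v$ is the ribbon element of $\mathfrak u_\zeta$. For all integers $0\le\ell_1,m_1,n_1,\ell_2,m_2,n_2\le r-1$, $$\rho_2^{\mathfrak u_\zeta}(\tau_\gamma)\left(E^{\ell_1}T_{m_1}F^{(n_1)}\otimes E^{\ell_2}T_{m_2}F^{(n_2)}\right)\propto\zeta^{2(m_1-n_1+\ell_2-m_2+1)(m_1-n_1+\ell_2-m_2)}\sum_{j_1=0}^{r-1}\sum_{i_1=0}^{r-j_1-1}\sum_{k_2=0}^{r-i_1-j_1-1}\sum_{b=-k_2}^{i_1+j_1}\sum_{i_2=0}^{b+k_2}(-1)^b$$ $$\begin{bmatrix} i_1+j_1+k_2 \\ i_1,j_1 \end{bmatrix}_\zeta\begin{bmatrix} \ell_2+k_2 \\ b-i_2+k_2 \end{bmatrix}_\zeta\begin{bmatrix} n_1-b+j_1 \\ n_1-i_1 \end{bmatrix}_\zeta\begin{bmatrix} n_2+i_2 \\ n_2 \end{bmatrix}_\zeta\{2m_1-n_1+i_1+j_1;i_1\}_\zeta\{-\ell_2+2m_2+b;b-i_2+k_2\}_\zeta$$ $$\zeta^{\frac{(i_1+j_1+k_2+3)(i_1+j_1+k_2)}2-(i_1+j_1+k_2-1)b+2(m_1-n_1+2(\ell_2-m_2))(i_1+j_1)+2(\ell_2-m_2)k_2}$$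 $$E^{\ell_1+j_1}T_{m_1+j_1}F^{(n_1+j_1-b)}\otimes E^{\ell_2-b+i_2}T_{m_2+i_2}F^{(n_2+i_2)},$$ where $\propto$ means equality up to a nonzero complex scalar that does not depend on $\ell_1,m_1,n_1,\ell_2,m_2,n_2$.
   Context: $\mathfrak u_\zeta$ is the $\mathbb C$-algebra with generators $E,F^{(1)},K$ and relations $E^r=(F^{(1)})^r=0$, $K^r=1$, $KEK^{-1}=\zeta^2E$, $KF^{(1)}K^{-1}=\zeta^{-2}F^{(1)}$, $[E,F^{(1)}]=K-K^{-1}$, with $\Delta(E)=E\otimes K+1\otimes E$, $\Delta(F^{(1)})=K^{-1}\otimes F^{(1)}+F^{(1)}\otimes1$, $\Delta(K)=K\otimes K$, $S(E)=-EK^{-1}$, $S(F^{(1)})=-KF^{(1)}$, $S(K)=K^{-1}$; Sweedler notation $\Delta(x)=x_{(1)}\otimes x_{(2)}$. $\{n\}_\zeta=\zeta^n-\zeta^{-n}$, $[n]_\zeta=\{n\}_\zeta/\{1\}_\zeta$, $\{n;k\}_\zeta=\prod_{j=0}^{k-1}\{n-j\}_\zeta$. Quantum multinomials $\begin{bmatrix}k\\\ell_1,\dots,\ell_j\end{bmatrix}_q=\frac{[k]_q!}{[\ell_1]_q!\cdots[\ell_j]_q![k-\ell_1-\dots-\ell_j]_q!}\in\mathbb Z[q^{\pm1}]$ for $k,\ell_i\ge0$, $\sum\ell_i\le k$, zero otherwise, evaluated at $q=\zeta$. $F^{(a)}=(F^{(1)})^a/[a]_\zeta!$ for $0\le a\le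 r-1$; $F^{(a)}=0$ for $a<0$ or $a\ge r$; terms with negative powers of $E$ are zero; $T_a=\frac1r\sum_{b=0}^{r-1}\zeta^{2ab}K^b$ (index mod $r$). $\mathrm{ad}$ has underlying vector space $\mathfrak u_\zeta$. R-matrix $R=R'_i\otimes R''_i=\sum_{a,b=0}^{r-1}\zeta^{a(a-1)/2}K^{-b}E^a\otimes T_bF^{(a)}$, $u=S(R''_i)R'_i$, $v=uK^{-1}$. *)

(* Defs.v *)
From HB Require Import structures.
From mathcomp Require Import all_boot all_order all_algebra.
From mathcomp Require Import complex boolp reals trigo.

Set Implicit Arguments.
Unset Strict Implicit.
Unset Printing Implicit Defensive.

Import Order.TTheory GRing.Theory Num.Theory.
Local Open Scope ring_scope.
Local Open Scope quotient_scope.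

Section QCommute.
Variables (F : fieldType) (q : F).

Fixpoint gauss_binom n k : F :=
  match n, k with
  | _, 0 => 1
  | 0, _.+1 => 0
  | n'.+1, k'.+1 => gauss_binom n' k' + q ^+ k'.+1 * gauss_binom n' k'.+1
  end.

Lemma gauss_binom0 n : gauss_binom n 0 = 1. Proof. by case: n. Qed.

Lemma gauss_binom_small n k : (n < k)%N -> gauss_binom n k = 0.
Proof.
elim: n k => [|n IH] [|k] //= nk.
by rewrite !IH ?mulr0 ?addr0 // ltnW.
Qed.

Lemma gauss_binomE n k :
  gauss_binom n k * \prod_(i < k) (1 - q ^+ i.+1) =
    \prod_(i < k) (1 - q ^+ (n - i)).
Proof.
elim: n k => [|n IH] [|k]; rewrite ?gauss_binom0 ?big_ord0 ?mulr1 //=.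
  by rewrite mul0r big_ord_recl /= subn0 expr0 subrr mul0r.
rewrite mulrDl -mulrA (IH k.+1) [in X in X + _]big_ord_recr /= mulrA IH.
rewrite [in X in _ + X]big_ord_recr [in RHS]big_ord_recl /= subn0.
under [in RHS]eq_bigr => i _ do rewrite /bump /= add1n subSS.
have [kn|nk] := leqP k n; last first.
  have -> : \prod_(i < k) (1 - q ^+ (n - i)) = 0.
    by rewrite (bigD1 (Ordinal nk)) //= subnn expr0 subrr mul0r.
  by rewrite !(mul0r, mulr0) addr0.
have -> : q ^+ n.+1 = q ^+ k.+1 * q ^+ (n - k) by rewrite -exprD addSn subnKC.
by rewrite mulrCA [RHS]mulrC -mulrDr mulrBr mulr1 addrA subrK.
Qed.

Lemma gauss_binom_root n k :
  q ^+ n = 1 -> (forall i, (0 < i < n)%N -> q ^+ i != 1) ->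
  (0 < k < n)%N -> gauss_binom n k = 0.
Proof.
move=> qn1 qi /andP[k0 kn]; have /eqP := gauss_binomE n k.
rewrite [X in _ == X](_ : _ = 0); last first.
  by rewrite (bigD1 (Ordinal k0)) //= subn0 qn1 subrr mul0r.
rewrite mulf_eq0 => /orP[/eqP //|/prodf_eq0[i _]].
rewrite subr_eq0 eq_sym => /eqP qi1; have := qi i.+1.
by rewrite qi1 eqxx (leq_trans _ kn) ?ltnS // => /(_ isT).
Qed.

Variable A : algType F.
Variables x y : A.
Hypothesis yx : y * x = q *: (x * y).

Lemma qcomm_exp k : y * x ^+ k = q ^+ k *: (x ^+ k * y).
Proof.
elim: k => [|k IH]; first by rewrite scale1r mul1r mulr1.
rewrite [x ^+ _]exprS [LHS]mulrA yx -scalerAl -[x * y * _]mulrA IH.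
by rewrite -scalerAr scalerA -[q * _]exprS mulrA.
Qed.

Lemma qcomm_exprMn n : exists c : F, (x * y) ^+ n = c *: (x ^+ n * y ^+ n).
Proof.
elim: n => [|n [c IH]]; first by exists 1; rewrite scale1r mulr1.
exists (c * q ^+ n); rewrite exprS IH -scalerAr -mulrA [y * (_ * _)]mulrA.
rewrite qcomm_exp -scalerAl -scalerAr scalerA mulrA mulrA -exprS.
by rewrite -mulrA -exprS.
Qed.

Lemma qbinomial n :
  (x + y) ^+ n = \sum_(k < n.+1) gauss_binom n k *: (x ^+ k * y ^+ (n - k)).
Proof.
elim: n => [|n IH]; first by rewrite big_ord1 scale1r mulr1.
rewrite exprS IH mulrDl !mulr_sumr.
pose G k := (q ^+ k * gauss_binom n k) *: (x ^+ k * y ^+ (n.+1 - k)).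
have -> : \sum_(k < n.+1) y * (gauss_binom n k *: (x ^+ k * y ^+ (n - k))) =
          \sum_(k < n.+2) G k.
  rewrite [RHS]big_ord_recr /= {2}/G gauss_binom_small // mulr0 scale0r addr0.
  apply: eq_bigr => k _; rewrite /G -scalerAr mulrA qcomm_exp -scalerAl scalerA.
  by rewrite -mulrA -exprS mulrC subSn // -ltnS.
rewrite [X in _ + X]big_ord_recl [RHS]big_ord_recl /= addrCA; congr (_ + _).
  by rewrite /G mul1r gauss_binom0.
rewrite -big_split; apply: eq_bigr => k _ /=.
by rewrite /G /bump /= add1n subSS scalerDl -scalerAr mulrA -exprS.
Qed.

Lemma qbinomial_root n : (0 < n)%N ->
  q ^+ n = 1 -> (forall i, (0 < i < n)%N -> q ^+ i != 1) ->
  x ^+ n = 0 -> y ^+ n = 0 -> (x + y) ^+ n = 0.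
Proof.
move=> n0 qn qi xn yn; rewrite qbinomial big1 // => k _.
have [->|k0] := posnP k; first by rewrite subn0 yn mulr0 scaler0.
have [kn|] := ltnP k n; last first.
  by move=> nk; rewrite -(subnKC nk) exprD xn !mul0r scaler0.
by rewrite (gauss_binom_root qn qi) ?scale0r // k0.
Qed.
End QCommute.
HB.instance Definition _ (K : nzRingType) (A : lmodType K) :=
  GRing.Lmodule.on A^c.

Section ConverseAlgebra.
Variables (K : comNzRingType) (A : algType K).

HB.instance Definition _ := GRing.Lmodule_isLalgebra.Build K A^c
  (fun a (x y : A^c) => @scalerAr K A a y x).
HB.instance Definition _ := GRing.Lalgebra_isAlgebra.Build K A^c
  (fun a (x y : A^c) => @scalerAl K A a y x).
End ConverseAlgebra.

Definition bimap (K : nzRingType) (U V W : lmodType K) (f : U -> V -> W) :=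
  (forall y, linear (f^~ y)) /\ (forall x, linear (f x)).

(* Formal sums of pure tensors (scalars can be absorbed in the factors),
   identified as soon as no bilinear map distinguishes them. *)
Section Tensor.
Variables (K : comNzRingType) (U V : lmodType K).

Definition tens_eval (W : lmodType K) (f : U -> V -> W) (s : seq (U * V)) : W :=
  \sum_(x <- s) f x.1 x.2.

Definition tens_eqv : rel (seq (U * V)) := fun s t =>
  `[< forall (W : lmodType K) (f : U -> V -> W),
        bimap f -> tens_eval f s = tens_eval f t >].

Fact tens_eqv_refl : reflexive tens_eqv.
Proof. by move=> s; apply/asboolP. Qed.

Fact tens_eqv_sym : symmetric tens_eqv.
Proof.
by move=> s t; apply/asboolP/asboolP => st W f /st ->.
Qed.

Fact tens_eqv_trans : transitive tens_eqv.
Proof.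
move=> t s w /asboolP st /asboolP tw; apply/asboolP => W f bf.
by rewrite st ?tw.
Qed.

Canonical tens_equiv :=
  EquivRel tens_eqv tens_eqv_refl tens_eqv_sym tens_eqv_trans.

Definition tens := {eq_quot tens_equiv}.

HB.instance Definition _ := Choice.on tens.
HB.instance Definition _ := EqQuotient.on tens.

(* [tens_lift f] is the linear map x ⊗ y |-> f x y when f is bilinear. *)
Definition tens_lift (W : lmodType K) (f : U -> V -> W) (t : tens) : W :=
  tens_eval f (repr t).

Lemma tens_lift_pi (W : lmodType K) (f : U -> V -> W) s :
  bimap f -> tens_lift f (\pi_tens s) = tens_eval f s.
Proof.
move=> bf; have /eqmodP/asboolP/(_ W f bf) // : repr (\pi_tens s) = s %[mod tens].
by rewrite reprK.
Qed.

Lemma tens_ext (t t' : tens) :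
  (forall (W : lmodType K) (f : U -> V -> W),
     bimap f -> tens_lift f t = tens_lift f t') -> t = t'.
Proof.
move=> h; rewrite -[t]reprK -[t']reprK; apply/eqmodP/asboolP => W f bf.
exact: h.
Qed.

Definition tpure (x : U) (y : V) : tens := \pi_tens [:: (x, y)].

Lemma tens_lift_pure (W : lmodType K) (f : U -> V -> W) x y :
  bimap f -> tens_lift f (tpure x y) = f x y.
Proof. by move=> bf; rewrite tens_lift_pi // /tens_eval big_seq1. Qed.

Definition tens_zero : tens := \pi_tens [::].
Definition tens_add (t t' : tens) : tens := \pi_tens (repr t ++ repr t').
Definition tens_scale (a : K) (t : tens) : tens :=
  \pi_tens [seq (a *: x.1, x.2) | x <- repr t].
Definition tens_opp (t : tens) : tens := tens_scale (-1) t.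

Section LiftOps.
Variables (W : lmodType K) (f : U -> V -> W).
Hypothesis bf : bimap f.

Lemma tens_lift0 : tens_lift f tens_zero = 0.
Proof. by rewrite tens_lift_pi // /tens_eval big_nil. Qed.

Lemma tens_liftD t t' :
  tens_lift f (tens_add t t') = tens_lift f t + tens_lift f t'.
Proof. by rewrite tens_lift_pi // /tens_eval big_cat. Qed.

Lemma tens_liftZ a t : tens_lift f (tens_scale a t) = a *: tens_lift f t.
Proof.
rewrite tens_lift_pi // /tens_eval big_map scaler_sumr.
apply: eq_bigr => x _ /=.
by rewrite [LHS](scalable_linear (bf.1 x.2)).
Qed.
End LiftOps.

Let liftE := (tens_lift0, tens_liftD, tens_liftZ).

Fact tens_addA : associative tens_add.
Proof. by move=> x y z; apply: tens_ext => W f bf; rewrite !liftE // addrA. Qed.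
Fact tens_addC : commutative tens_add.
Proof. by move=> x y; apply: tens_ext => W f bf; rewrite !liftE // addrC. Qed.
Fact tens_add0 : left_id tens_zero tens_add.
Proof. by move=> x; apply: tens_ext => W f bf; rewrite !liftE // add0r. Qed.
Fact tens_addN : left_inverse tens_zero tens_opp tens_add.
Proof.
by move=> x; apply: tens_ext => W f bf; rewrite !liftE // scaleN1r addNr.
Qed.

HB.instance Definition _ :=
  GRing.isZmodule.Build tens tens_addA tens_addC tens_add0 tens_addN.

Fact tens_scaleA a b t : tens_scale a (tens_scale b t) = tens_scale (a * b) t.
Proof. by apply: tens_ext => W f bf; rewrite !liftE // scalerA. Qed.
Fact tens_scale1 : left_id 1 tens_scale.
Proof. by move=> t; apply: tens_ext => W f bf; rewrite !liftE // scale1r. Qed.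
Fact tens_scaleDr : right_distributive tens_scale +%R.
Proof. by move=> a t u; apply: tens_ext => W f bf; rewrite !liftE // scalerDr. Qed.
Fact tens_scaleDl t : {morph tens_scale^~ t : a b / a + b}.
Proof. by move=> a b; apply: tens_ext => W f bf; rewrite !liftE // scalerDl. Qed.

HB.instance Definition _ := GRing.Zmodule_isLmodule.Build K tens
  tens_scaleA tens_scale1 tens_scaleDr tens_scaleDl.

Lemma tens_lift_linear (W : lmodType K) (f : U -> V -> W) :
  bimap f -> linear (tens_lift f).
Proof.
by move=> bf a t u; rewrite [LHS]tens_liftD ?[in LHS]tens_liftZ.
Qed.

Lemma tens_lift_add (W : lmodType K) (f : U -> V -> W) t u :
  bimap f ->
  tens_lift f (t + u) = tens_lift f t + tens_lift f u.
Proof. by move=> bf; exact: tens_liftD. Qed.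

Lemma tpure_bilinear : bimap tpure.
Proof.
split=> [y|x] a u u'; apply: tens_ext => W f bf;
  rewrite tens_lift_linear // !tens_lift_pure //.
- exact: (bf.1 y).
- exact: (bf.2 x).
Qed.

Lemma tens_lift_fun_linear (W X : lmodType K) (g : X -> U -> V -> W) t :
  (forall x y, linear (fun w => g w x y)) -> linear (fun w => tens_lift (g w) t).
Proof.
move=> lg a x y; rewrite /tens_lift /tens_eval scaler_sumr -big_split /=.
by apply: eq_bigr => u _; exact: lg.
Qed.

Lemma tens_sum_pure (t : tens) : t = \sum_(x <- repr t) tpure x.1 x.2.
Proof.
apply: tens_ext => W f bf.
have lf := tens_lift_linear bf.
pose F : {linear tens -> W} :=
  HB.pack (tens_lift f) (GRing.isLinear.Build K tens W *:%R (tens_lift f) lf).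
rewrite -[RHS]/(F _) raddf_sum; apply: eq_bigr => x _ /=.
by rewrite /F /= tens_lift_pure.
Qed.

Lemma tens_linear_ext (W : lmodType K) (f g : tens -> W) :
  linear f -> linear g -> (forall x y, f (tpure x y) = g (tpure x y)) -> f =1 g.
Proof.
move=> lf lg fg t.
pose F : {linear tens -> W} :=
  HB.pack f (GRing.isLinear.Build K tens W *:%R f lf).
pose G : {linear tens -> W} :=
  HB.pack g (GRing.isLinear.Build K tens W *:%R g lg).
rewrite -[f]/(F : tens -> W) -[g]/(G : tens -> W) (tens_sum_pure t) !raddf_sum.
by apply: eq_bigr => x _; exact: fg.
Qed.
End Tensor.

Notation "x ⊗ y" := (tpure x y) (at level 40, left associativity) : ring_scope.

Section TensorRing.
Variables (K : comNzRingType) (A B : algType K).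
Local Notation T := (tens A B).

Lemma tens_ind (P : T -> Prop) :
    (forall x y, P (x ⊗ y)) -> (forall t u, P t -> P u -> P (t + u)) ->
  forall t, P t.
Proof.
move=> Pp PD t; rewrite (tens_sum_pure t).
elim: {t}(repr t) => [|x s IHs]; last by rewrite big_cons; apply: PD.
rewrite big_nil; have <- : (0 : A) ⊗ (0 : B) = 0; last exact: Pp.
by have := scalable_linear ((tpure_bilinear A B).1 0) 0 0; rewrite /= !scale0r.
Qed.

Let mulf (x : A) (y : B) (x' : A) (y' : B) : T := (x * x') ⊗ (y * y').

Let mulf_bil x y : bimap (mulf x y).
Proof.
split=> [y'|x'] a u u'; rewrite /mulf.
- by rewrite mulrDr -scalerAr; exact: (tpure_bilinear A B).1.
- by rewrite mulrDr -scalerAr; exact: (tpure_bilinear A B).2.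
Qed.

Definition tens_mul (t t' : T) : T :=
  tens_lift (fun x y => tens_lift (fun x' y' => (x * x') ⊗ (y * y')) t') t.

Let mulf_bil2 t' : bimap (fun x y => tens_lift (mulf x y) t').
Proof.
split=> [y|x] a u u'; elim/tens_ind: t' => [x' y'|t t' IH IH'];
  rewrite ?tens_lift_pure //.
- by rewrite /mulf mulrDl -scalerAl; exact: (tpure_bilinear A B).1.
- by rewrite !tens_lift_add // IH IH' scalerDr addrACA.
- by rewrite /mulf mulrDl -scalerAl; exact: (tpure_bilinear A B).2.
- by rewrite !tens_lift_add // IH IH' scalerDr addrACA.
Qed.

Lemma tens_mul_pure x y x' y' :
  tens_mul (x ⊗ y) (x' ⊗ y') = (x * x') ⊗ (y * y').
Proof. by rewrite /tens_mul (tens_lift_pure _ _ (mulf_bil2 _)) tens_lift_pure. Qed.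

Lemma tens_mul_linearl t' : linear (tens_mul^~ t').
Proof. by move=> a t u; rewrite /= /tens_mul (tens_lift_linear (mulf_bil2 t')). Qed.

Lemma tens_mul_linearr t : linear (tens_mul t).
Proof.
move=> a u u'; rewrite /tens_mul {1}/tens_lift {1}/tens_eval.
rewrite [in RHS]/tens_lift /tens_eval scaler_sumr -big_split /=.
by apply: eq_bigr => x _; rewrite -(tens_lift_linear (mulf_bil x.1 x.2)).
Qed.

Fact tens_mulDl : left_distributive tens_mul +%R.
Proof.
by move=> t u v; have := tens_mul_linearl v 1 t u; rewrite /= !scale1r.
Qed.

Fact tens_mulDr : right_distributive tens_mul +%R.
Proof.
by move=> t u v; have := tens_mul_linearr t 1 u v; rewrite /= !scale1r.
Qed.

Fact tens_mulA : associative tens_mul.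
Proof.
elim/tens_ind => [x y u v|t t' IH IH' u v]; last by rewrite !tens_mulDl IH IH'.
elim/tens_ind: u => [x' y'|t t' IH IH']; last first.
  by rewrite tens_mulDl !tens_mulDr tens_mulDl IH IH'.
elim/tens_ind: v => [x'' y''|t t' IH IH']; last by rewrite !tens_mulDr IH IH'.
by rewrite !tens_mul_pure !mulrA.
Qed.

Fact tens_mul1l : left_id (1 ⊗ 1) tens_mul.
Proof.
elim/tens_ind => [x y|t t' IH IH']; last by rewrite tens_mulDr IH IH'.
by rewrite tens_mul_pure !mul1r.
Qed.

Fact tens_mul1r : right_id (1 ⊗ 1) tens_mul.
Proof.
elim/tens_ind => [x y|t t' IH IH']; last by rewrite tens_mulDl IH IH'.
by rewrite tens_mul_pure !mulr1.
Qed.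

HB.instance Definition _ := GRing.Zmodule_isPzRing.Build T
  tens_mulA tens_mul1l tens_mul1r tens_mulDl tens_mulDr.

Lemma tens_pureM (x x' : A) (y y' : B) :
  (x ⊗ y) * (x' ⊗ y') = (x * x') ⊗ (y * y') :> T.
Proof. exact: tens_mul_pure. Qed.

Lemma tens_pureX (x : A) (y : B) n : (x ⊗ y) ^+ n = (x ^+ n) ⊗ (y ^+ n) :> T.
Proof. by elim: n => // n IH; rewrite !exprS IH tens_pureM. Qed.

Lemma tens_scaleAl (a : K) (t u : T) : a *: (t * u) = (a *: t) * u.
Proof.
have := tens_mul_linearl u a t 0; rewrite /= !addr0.
have -> : tens_mul 0 u = 0 :> T by exact: (@mul0r T u).
by rewrite addr0 => /esym.
Qed.

Lemma tens_scaleAr (a : K) (t u : T) : a *: (t * u) = t * (a *: u).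
Proof.
have := tens_mul_linearr t a u 0; rewrite /= !addr0.
have -> : tens_mul t 0 = 0 :> T by exact: (@mulr0 T t).
by rewrite addr0 => /esym.
Qed.
End TensorRing.

Definition zeta (R : realType) (r : nat) : R[i] :=
  (cos (2 * pi / r%:R) +i* sin (2 * pi / r%:R))%C.

Record oddlevel := OddLevel {
  level :> nat;
  level_ge3 : (3 <= level)%N;
  level_odd : odd level
}.

Lemma level_gt0 (r : oddlevel) : (0 < r)%N.
Proof. exact: leq_trans (level_ge3 r). Qed.

Inductive ncexpr (K : Type) :=
  | NcE | NcF | NcK
  | NcConst of K
  | NcAdd of ncexpr K & ncexpr K
  | NcMul of ncexpr K & ncexpr K.

HB.instance Definition _ K := gen_eqMixin (ncexpr K).
HB.instance Definition _ K := gen_choiceMixin (ncexpr K).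

Fixpoint nceval (K : comNzRingType) (A : algType K) (e f k : A) (p : ncexpr K)
    : A :=
  match p with
  | NcE => e
  | NcF => f
  | NcK => k
  | NcConst c => c%:A
  | NcAdd p q => nceval e f k p + nceval e f k q
  | NcMul p q => nceval e f k p * nceval e f k q
  end.

Definition irange (a b : int) : seq int :=
  [seq a + i%:Z | i <- iota 0 (if a <= b then `|b - a|.+1 else 0)].

Definition qfact_poly (n : nat) : {poly int} :=
  \prod_(1 <= m < n.+1) \sum_(i < m) 'X^(2 * i).

Section SmallQuantumGroup.
Variables (R : realType) (r : oddlevel).
Local Notation C := R[i].
Local Notation z := (zeta R r).

(* Since k ^+ r = 1, the power k ^+ r.-1 is k^-1. *)
Definition uz_rels (A : algType C) (e f k : A) : Prop :=
  [/\ e ^+ r = 0, f ^+ r = 0, k ^+ r = 1 &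
  [/\ k * e * k ^+ r.-1 = z ^+ 2 *: e,
      k * f * k ^+ r.-1 = z ^- 2 *: f &
      e * f - f * e = k - k ^+ r.-1]].

(* The algebra presented by [uz_rels]: two expressions are identified when
   they agree in every algebra in which the relations hold. *)
Definition uz_eqv : rel (ncexpr C) := fun p q =>
  `[< forall (A : algType C) (e f k : A),
        uz_rels e f k -> nceval e f k p = nceval e f k q >].

Fact uz_eqv_refl : reflexive uz_eqv.
Proof. by move=> p; apply/asboolP. Qed.

Fact uz_eqv_sym : symmetric uz_eqv.
Proof. by move=> p q; apply/asboolP/asboolP => pq A e f k /pq ->. Qed.

Fact uz_eqv_trans : transitive uz_eqv.
Proof.
move=> q p s /asboolP pq /asboolP qs; apply/asboolP => A e f k h.
by rewrite (pq _ _ _ _ h) (qs _ _ _ _ h).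
Qed.

Canonical uz_equiv := EquivRel uz_eqv uz_eqv_refl uz_eqv_sym uz_eqv_trans.

Definition uz := {eq_quot uz_equiv}.
HB.instance Definition _ := Choice.on uz.
HB.instance Definition _ := EqQuotient.on uz.

(* The algebra morphism sending E, F, K to e, f, k when these satisfy
   the relations. *)
Definition uz_lift (A : algType C) (e f k : A) (x : uz) : A :=
  nceval e f k (repr x).

Lemma uz_lift_pi (A : algType C) (e f k : A) p :
  uz_rels e f k -> uz_lift e f k (\pi_uz p) = nceval e f k p.
Proof.
move=> h; have /eqmodP/asboolP/(_ A e f k h) // : repr (\pi_uz p) = p %[mod uz].
by rewrite reprK.
Qed.

Lemma uz_ext (x y : uz) :
  (forall (A : algType C) (e f k : A),
     uz_rels e f k -> uz_lift e f k x = uz_lift e f k y) -> x = y.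
Proof.
move=> h; rewrite -[x]reprK -[y]reprK; apply/eqmodP/asboolP => A e f k.
exact: h.
Qed.

Definition uz_const (c : C) : uz := \pi_uz (NcConst c).
Definition uz_add (x y : uz) : uz := \pi_uz (NcAdd (repr x) (repr y)).
Definition uz_mul (x y : uz) : uz := \pi_uz (NcMul (repr x) (repr y)).
Definition uz_scale (c : C) (x : uz) : uz := uz_mul (uz_const c) x.
Definition uz_opp (x : uz) : uz := uz_scale (-1) x.

Section LiftOps.
Variables (A : algType C) (e f k : A).
Hypothesis h : uz_rels e f k.
Local Notation lift := (uz_lift e f k).

Lemma uz_lift_const c : lift (uz_const c) = c%:A.
Proof. by rewrite uz_lift_pi. Qed.
Lemma uz_liftD0 x y : lift (uz_add x y) = lift x + lift y.
Proof. by rewrite uz_lift_pi. Qed.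
Lemma uz_liftM0 x y : lift (uz_mul x y) = lift x * lift y.
Proof. by rewrite uz_lift_pi. Qed.
Lemma uz_liftZ0 c x : lift (uz_scale c x) = c *: lift x.
Proof. by rewrite uz_liftM0 uz_lift_const mulr_algl. Qed.
Lemma uz_liftN0 x : lift (uz_opp x) = - lift x.
Proof. by rewrite uz_liftZ0 scaleN1r. Qed.
End LiftOps.

Let liftE := (uz_liftD0, uz_liftN0, uz_liftM0, uz_liftZ0, uz_lift_const).
Local Ltac uz_tac := apply: uz_ext => ? ? ? ? ?; rewrite ?liftE //.

Fact uz_addA : associative uz_add.
Proof. by move=> x y w; uz_tac; rewrite addrA. Qed.
Fact uz_addC : commutative uz_add.
Proof. by move=> x y; uz_tac; rewrite addrC. Qed.
Fact uz_add0 : left_id (uz_const 0) uz_add.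
Proof. by move=> x; uz_tac; rewrite scale0r add0r. Qed.
Fact uz_addN : left_inverse (uz_const 0) uz_opp uz_add.
Proof. by move=> x; uz_tac; rewrite scale0r addNr. Qed.

HB.instance Definition _ :=
  GRing.isZmodule.Build uz uz_addA uz_addC uz_add0 uz_addN.

Fact uz_mulA : associative uz_mul.
Proof. by move=> x y w; uz_tac; rewrite mulrA. Qed.
Fact uz_mul1l : left_id (uz_const 1) uz_mul.
Proof. by move=> x; uz_tac; rewrite scale1r mul1r. Qed.
Fact uz_mul1r : right_id (uz_const 1) uz_mul.
Proof. by move=> x; uz_tac; rewrite scale1r mulr1. Qed.
Fact uz_mulDl : left_distributive uz_mul uz_add.
Proof. by move=> x y w; uz_tac; rewrite mulrDl. Qed.
Fact uz_mulDr : right_distributive uz_mul uz_add.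
Proof. by move=> x y w; uz_tac; rewrite mulrDr. Qed.

(* The counit provides a one-dimensional model of the relations. *)
Lemma uz_rels_counit : @uz_rels C^o 0 0 1.
Proof.
have r0 : (r == 0 :> nat) = false by apply/negbTE; rewrite -lt0n level_gt0.
split; rewrite ?expr0n ?r0 ?expr1n //.
by split; rewrite ?(mulr0, mul0r, scaler0, subrr).
Qed.

Fact uz_1neq0 : uz_const 1 != 0.
Proof.
apply/eqP => /(congr1 (@uz_lift C^o 0 0 1)).
rewrite -[RHS]/(uz_lift _ _ _ (uz_const 0)) !uz_lift_const; last 2 first.
- exact: uz_rels_counit.
- exact: uz_rels_counit.
by rewrite scale1r scale0r => /eqP; rewrite oner_eq0.
Qed.

HB.instance Definition _ := GRing.Zmodule_isNzRing.Build uz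
  uz_mulA uz_mul1l uz_mul1r uz_mulDl uz_mulDr uz_1neq0.

Fact uz_scaleA a b x : uz_scale a (uz_scale b x) = uz_scale (a * b) x.
Proof. by uz_tac; rewrite scalerA. Qed.
Fact uz_scale1 : left_id 1 uz_scale.
Proof. by move=> x; uz_tac; rewrite scale1r. Qed.
Fact uz_scaleDr : right_distributive uz_scale +%R.
Proof. by move=> a x y; uz_tac; rewrite scalerDr. Qed.
Fact uz_scaleDl x : {morph uz_scale^~ x : a b / a + b}.
Proof. by move=> a b; uz_tac; rewrite scalerDl. Qed.

HB.instance Definition _ := GRing.Zmodule_isLmodule.Build C uz
  uz_scaleA uz_scale1 uz_scaleDr uz_scaleDl.

Fact uz_scaleAl a x y : uz_scale a (uz_mul x y) = uz_mul (uz_scale a x) y.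
Proof. by uz_tac; rewrite scalerAl. Qed.
Fact uz_scaleAr a x y : uz_scale a (uz_mul x y) = uz_mul x (uz_scale a y).
Proof. by uz_tac; rewrite scalerAr. Qed.

HB.instance Definition _ := GRing.Lmodule_isLalgebra.Build C uz uz_scaleAl.
HB.instance Definition _ := GRing.Lalgebra_isAlgebra.Build C uz uz_scaleAr.

Definition uz_unit (x : uz) : bool := `[< exists y, y * x = 1 /\ x * y = 1 >].
Definition uz_inv (x : uz) : uz :=
  if pselect (exists y, y * x = 1 /\ x * y = 1) is left h
  then projT1 (cid h) else x.

Fact uz_mulVr : {in uz_unit, left_inverse 1 uz_inv *%R}.
Proof.
move=> x /asboolP ux; rewrite /uz_inv; case: pselect => // h.
by case: (cid h) => y /= [].
Qed.
Fact uz_mulrV : {in uz_unit, right_inverse 1 uz_inv *%R}.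
Proof.
move=> x /asboolP ux; rewrite /uz_inv; case: pselect => // h.
by case: (cid h) => y /= [].
Qed.
Fact uz_unitP (x y : uz) : y * x = 1 /\ x * y = 1 -> uz_unit x.
Proof. by move=> h; apply/asboolP; exists y. Qed.
Fact uz_inv_out : {in [predC uz_unit], uz_inv =1 id}.
Proof.
by move=> x /asboolPn ux; rewrite /uz_inv; case: pselect.
Qed.

HB.instance Definition _ := GRing.NzRing_hasMulInverse.Build uz
  uz_mulVr uz_mulrV uz_unitP uz_inv_out.

Definition uE : uz := \pi_uz (NcE C).
Definition uF : uz := \pi_uz (NcF C).
Definition uK : uz := \pi_uz (NcK C).

Section Lift.
Variables (A : algType C) (e f k : A).
Hypothesis h : uz_rels e f k.
Local Notation lift := (uz_lift e f k).

Lemma uz_liftE : lift uE = e. Proof. by rewrite uz_lift_pi. Qed.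
Lemma uz_liftF : lift uF = f. Proof. by rewrite uz_lift_pi. Qed.
Lemma uz_liftK : lift uK = k. Proof. by rewrite uz_lift_pi. Qed.
Lemma uz_lift1 : lift 1 = 1.
Proof. by rewrite [LHS]uz_lift_const // scale1r. Qed.
Lemma uz_liftD x y : lift (x + y) = lift x + lift y.
Proof. exact: uz_liftD0. Qed.
Lemma uz_liftN x : lift (- x) = - lift x.
Proof. exact: uz_liftN0. Qed.
Lemma uz_liftM x y : lift (x * y) = lift x * lift y.
Proof. exact: uz_liftM0. Qed.
Lemma uz_liftZ c x : lift (c *: x) = c *: lift x.
Proof. exact: uz_liftZ0. Qed.
Lemma uz_liftX x n : lift (x ^+ n) = lift x ^+ n.
Proof.
by elim: n => [|n IH]; rewrite ?expr0 ?uz_lift1 // !exprS uz_liftM IH.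
Qed.
Lemma uz_lift_linear : linear lift.
Proof. by move=> c x y; rewrite uz_liftD uz_liftZ. Qed.
End Lift.

Lemma uz_relsP : uz_rels uE uF uK.
Proof.
have l0 (A : algType C) (e f k : A) :
    uz_rels e f k -> uz_lift e f k 0 = 0.
  by move=> h; rewrite [LHS]uz_lift_const // scale0r.
split; [| | |split]; apply: uz_ext => A e f k h;
  rewrite ?(uz_liftD h) ?(uz_liftN h) ?(uz_liftZ h)
    ?(uz_liftX h, uz_liftM h);
  rewrite ?(l0 _ _ _ _ h, uz_lift1 h, uz_liftE h, uz_liftF h, uz_liftK h);
  by case: h => ? ? ? [].
Qed.

Lemma uK_unit : uK \is a GRing.unit.
Proof.
have [_ _ h _] := uz_relsP.
by rewrite -(unitrX_pos _ (level_gt0 r)) h unitr1.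
Qed.

Lemma uz_ind (P : uz -> Prop) :
    P uE -> P uF -> P uK -> (forall c : C, P c%:A) ->
    (forall x y, P x -> P y -> P (x + y)) ->
    (forall x y, P x -> P y -> P (x * y)) -> forall x, P x.
Proof.
move=> PE PF PK PC PD PM x; rewrite -[x]reprK.
elim: {x}(repr x) => // [c|p IHp q IHq|p IHp q IHq].
- have <- : c%:A = \pi_uz (NcConst c) :> uz; last exact: PC.
  by apply: uz_ext => A e f k h; rewrite uz_liftZ // uz_lift1 // uz_lift_const.
- have <- : \pi_uz p + \pi_uz q = \pi_uz (NcAdd p q) :> uz; last exact: PD.
  by apply: uz_ext => A e f k h; rewrite uz_liftD // !uz_lift_pi.
- have <- : \pi_uz p * \pi_uz q = \pi_uz (NcMul p q) :> uz; last exact: PM.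
  by apply: uz_ext => A e f k h; rewrite uz_liftM // !uz_lift_pi.
Qed.

Local Notation U2 := (tens uz uz).

Fact uz2_1neq0 : 1 != 0 :> U2.
Proof.
pose eps := @uz_lift C^o 0 0 1.
have he := uz_rels_counit.
have bil : bimap (fun x y : uz => (eps x * eps y : C^o)).
  split=> [y|x] a u v; rewrite /eps (uz_lift_linear he).
    by rewrite mulrDl -scalerAl.
  by rewrite mulrDr -scalerAr.
apply/eqP => /(congr1 (tens_lift (fun x y : uz => (eps x * eps y : C^o)))).
rewrite (tens_lift_pure _ _ bil) [RHS](tens_lift0 bil) /eps !(uz_lift1 he) mulr1.
by move/eqP; rewrite oner_eq0.
Qed.

HB.instance Definition _ := GRing.PzSemiRing_isNonZero.Build U2 uz2_1neq0.
HB.instance Definition _ :=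
  GRing.Lmodule_isLalgebra.Build C U2 (@tens_scaleAl C uz uz).
HB.instance Definition _ :=
  GRing.Lalgebra_isAlgebra.Build C U2 (@tens_scaleAr C uz uz).

Definition uz_comul : uz -> U2 :=
  uz_lift (uE ⊗ uK + 1 ⊗ uE) (uK^-1 ⊗ uF + uF ⊗ 1) (uK ⊗ uK).

(* The antipode is an anti-morphism, i.e. a morphism to the converse algebra. *)
Definition uz_antipode : uz -> uz :=
  @uz_lift uz^c (- uE * uK^-1) (- uK * uF) uK^-1.

Lemma uK_inv : uK ^+ r.-1 = uK^-1.
Proof.
have [_ _ h _] := uz_relsP.
by apply: (mulrI uK_unit); rewrite -exprS prednK ?level_gt0 // h divrr ?uK_unit.
Qed.

Lemma uKE : uK * uE = z ^+ 2 *: (uE * uK).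
Proof.
have [_ _ _ []] := uz_relsP; rewrite uK_inv => h _ _.
by rewrite scalerAl -h mulrVK ?uK_unit.
Qed.

Lemma uKF : uK * uF = z ^- 2 *: (uF * uK).
Proof.
have [_ _ _ []] := uz_relsP; rewrite uK_inv => _ h _.
by rewrite scalerAl -h mulrVK ?uK_unit.
Qed.

Lemma uEF : uE * uF - uF * uE = uK - uK^-1.
Proof. by have [_ _ _ []] := uz_relsP; rewrite uK_inv. Qed.

Lemma zeta_neq0 : z != 0.
Proof.
apply/eqP => /eqP; rewrite eq_complex /= => /andP[/eqP c0 /eqP s0].
have := cos2Dsin2 (2 * pi / r%:R : R).
by rewrite c0 s0 expr0n addr0 => /eqP; rewrite eq_sym oner_eq0.
Qed.

Lemma zetaX n :
  z ^+ n = (cos (n%:R * (2 * pi / r%:R)) +i* sin (n%:R * (2 * pi / r%:R)))%C.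
Proof.
elim: n => [|n IH]; first by rewrite mul0r cos0 sin0.
rewrite exprS IH /zeta; set t : R := 2 * pi / r%:R.
have -> : n.+1%:R * t = t + n%:R * t by rewrite mulrS mulrDl mul1r.
by rewrite cosD sinD; simpc; congr (_ +i* _)%C; rewrite addrC.
Qed.

Lemma zeta_exp1 : z ^+ r = 1.
Proof.
have r0 : (r%:R : R) != 0 by rewrite pnatr_eq0 -lt0n level_gt0.
rewrite zetaX mulrC divfK // mulrC.
by rewrite mulr_natr cos2pi sin2pi.
Qed.

Lemma zeta_exp_neq1 n : (0 < n < r)%N -> z ^+ n != 1.
Proof.
move=> /andP[n0 nr]; rewrite zetaX eq_complex /= negb_and; apply/orP; left.
pose t : R := n%:R * pi / r%:R.
have r0 : (0 < r%:R :> R) by rewrite ltr0n level_gt0.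
have -> : n%:R * (2 * pi / r%:R) = t *+ 2 :> R.
  by rewrite /t -[2 * pi / _]mulrA mulrCA (mulr_natl _ 2) mulrA.
rewrite cos_mulr2n; apply/negP => /eqP h.
have st : 0 < sin t.
  apply: sin_gt0_pi; apply/andP; split.
    by rewrite /t divr_gt0 // mulr_gt0 ?pi_gt0 // ltr0n.
  by rewrite /t ltr_pdivrMr // mulrC ltr_pM2l ?pi_gt0 // ltr_nat.
have := cos2Dsin2 t.
have -> : cos t ^+ 2 = 1.
  have : cos t ^+ 2 *+ 2 = 1 *+ 2 by rewrite [RHS]mulr2n -{1}h subrK.
  by move/eqP; rewrite eqrMn2r => /eqP.
move=> /eqP; rewrite -subr_eq0 addrAC subrr add0r sqrf_eq0.
by rewrite (gt_eqF st).
Qed.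

Lemma zeta2_exp1 : (z ^+ 2) ^+ r = 1.
Proof. by rewrite exprAC zeta_exp1 expr1n. Qed.

Lemma zeta2_exp_neq1 i : (0 < i < r)%N -> (z ^+ 2) ^+ i != 1.
Proof.
move=> /andP[i0 ir]; rewrite -exprM.
have [lt|ge] := ltnP (2 * i) r; first by rewrite zeta_exp_neq1 // muln_gt0 i0.
have e : (2 * i)%N = (r + (2 * i - r))%N by rewrite subnKC.
rewrite e exprD zeta_exp1 mul1r zeta_exp_neq1 //; apply/andP; split.
  rewrite subn_gt0 ltn_neqAle ge andbT; apply/eqP => h.
  by have := level_odd r; rewrite h mul2n odd_double.
by rewrite ltn_subLR // mul2n -addnn -addSn leq_add // ltnW.
Qed.

Let tpDl (x x' y : uz) : (x + x') ⊗ y = x ⊗ y + x' ⊗ y.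
Proof. by have := (tpure_bilinear uz uz).1 y 1 x x'; rewrite /= !scale1r. Qed.
Let tpDr (x y y' : uz) : x ⊗ (y + y') = x ⊗ y + x ⊗ y'.
Proof. by have := (tpure_bilinear uz uz).2 x 1 y y'; rewrite /= !scale1r. Qed.
Let tp0l (y : uz) : (0 : uz) ⊗ y = 0.
Proof. by apply: (addrI ((0 : uz) ⊗ y)); rewrite -tpDl !addr0. Qed.
Let tp0r (x : uz) : x ⊗ (0 : uz) = 0.
Proof. by apply: (addrI (x ⊗ (0 : uz))); rewrite -tpDr !addr0. Qed.
Let tpZl a (x y : uz) : (a *: x) ⊗ y = a *: (x ⊗ y).
Proof. by have := (tpure_bilinear uz uz).1 y a x 0; rewrite /= tp0l !addr0. Qed.
Let tpZr a (x y : uz) : x ⊗ (a *: y) = a *: (x ⊗ y).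
Proof. by have := (tpure_bilinear uz uz).2 x a y 0; rewrite /= tp0r !addr0. Qed.
Let tpNl (x y : uz) : (- x) ⊗ y = - (x ⊗ y).
Proof. by rewrite -scaleN1r tpZl scaleN1r. Qed.
Let tpNr (x y : uz) : x ⊗ (- y) = - (x ⊗ y).
Proof. by rewrite -scaleN1r tpZr scaleN1r. Qed.

Let z2_neq0 : z ^+ 2 != 0. Proof. by rewrite expf_neq0 ?zeta_neq0. Qed.

Lemma uKVF : uK^-1 * uF = z ^+ 2 *: (uF * uK^-1).
Proof.
apply: (mulrI uK_unit); rewrite mulVKr ?uK_unit // -scalerAr mulrA uKF.
by rewrite -scalerAl scalerA mulfV // scale1r mulrK ?uK_unit.
Qed.

Lemma uEKV : uE * uK^-1 = z ^+ 2 *: (uK^-1 * uE).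
Proof.
apply: (mulIr uK_unit); rewrite mulrVK ?uK_unit // -scalerAl -mulrA.
apply: (mulrI uK_unit); rewrite -scalerAr mulVKr ?uK_unit //.
exact: uKE.
Qed.

Lemma uFE_comm_K : uK * (uF * uE) * uK^-1 = uF * uE.
Proof.
rewrite mulrA uKF -scalerAl -[uF * uK * uE]mulrA uKE -scalerAr scalerA.
by rewrite mulVf // scale1r mulrA mulrK ?uK_unit.
Qed.

Let sum8 (V : zmodType) (a b c d x y : V) :
  a + b + (c + d) + (- a - x + (- y - d)) = b - y + (c - x).
Proof.
by rewrite [LHS](AC ((2*2)*(2*2))%AC ((2*7)*(3*6)*(1*5)*(4*8))%AC) /=
  !subrr !addr0.
Qed.

Let er := uz_relsP.

Lemma uz_comul_rels :
  uz_rels (uE ⊗ uK + 1 ⊗ uE) (uK^-1 ⊗ uF + uF ⊗ 1) (uK ⊗ uK : U2).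
Proof.
have [Er Fr Kr _] := er.
have r0 := level_gt0 r.
split.
- rewrite addrC; apply: (@qbinomial_root _ (z ^+ 2)) => //.
  + by rewrite !tens_pureM mul1r mulr1 uKE tpZr.
  + exact: zeta2_exp1.
  + exact: zeta2_exp_neq1.
  + by rewrite tens_pureX Er tp0r.
  + by rewrite tens_pureX Er tp0l.
- rewrite addrC; apply: (@qbinomial_root _ (z ^+ 2)) => //.
  + by rewrite !tens_pureM mul1r mulr1 uKVF tpZl.
  + exact: zeta2_exp1.
  + exact: zeta2_exp_neq1.
  + by rewrite tens_pureX Fr tp0l.
  + by rewrite tens_pureX Fr tp0r.
- by rewrite tens_pureX Kr.
have KV : (uK ⊗ uK : U2) ^+ r.-1 = uK^-1 ⊗ uK^-1 by rewrite tens_pureX uK_inv.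
have KK := mulrV uK_unit.
rewrite KV; split.
- rewrite mulrDr mulrDl !tens_pureM mulr1 KK uKE !mulrK ?uK_unit //.
  by rewrite -!scalerAl !mulrK ?uK_unit // tpZl tpZr scalerDr.
- rewrite mulrDr mulrDl !tens_pureM mulr1 KK uKF mul1r.
  by rewrite -!scalerAl !mulrK ?uK_unit // tpZl tpZr scalerDr.
rewrite !mulrDl !mulrDr !tens_pureM !mulr1 !mul1r.
rewrite uEKV uKF tpZl tpZr scalerA mulfV // scale1r.
rewrite opprD !opprD.
have -> : uK ⊗ uK - uK^-1 ⊗ uK^-1 =
  (uE * uF - uF * uE) ⊗ uK + uK^-1 ⊗ (uE * uF - uF * uE).
  by rewrite uEF tpDl tpDr tpNl tpNr addrA subrK.
rewrite !tpDl !tpDr !tpNl !tpNr.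
exact: sum8.
Qed.

Lemma uz_antipode_rels :
  @uz_rels uz^c (- uE * uK^-1) (- uK * uF) uK^-1.
Proof.
have [Er Fr Kr _] := er.
have r0 := level_gt0 r.
have KVr : uK^-1 ^+ r = 1 by rewrite exprVn Kr invr1.
have KV : uK^-1 ^+ r.-1 = uK by rewrite exprVn uK_inv invrK.
split.
- rewrite revrX mulNr exprNn.
  have [|c ->] := @qcomm_exprMn _ (z ^- 2) _ uE uK^-1 _ r.
    by rewrite uEKV scalerA mulVf ?scale1r.
  by rewrite Er mul0r scaler0 mulr0.
- rewrite revrX mulNr exprNn.
  have [|c ->] := @qcomm_exprMn _ (z ^+ 2) _ uK uF _ r.
    by rewrite uKF scalerA mulfV ?scale1r.
  by rewrite Fr mulr0 scaler0 mulr0.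
- by rewrite revrX.
rewrite revrX KV; split.
- change (uK * (- uE * uK^-1 * uK^-1) = z ^+ 2 *: (- uE * uK^-1)).
  rewrite mulNr mulNr mulrN !mulrA uKE -!scalerAl mulrK ?uK_unit //.
  by rewrite scalerN.
- change (uK * (- uK * uF * uK^-1) = z ^- 2 *: (- uK * uF)).
  rewrite mulNr mulNr mulrN uKF -scalerAl mulrK ?uK_unit //.
  by rewrite -scalerAr uKF scalerN.
change ((- uK * uF) * (- uE * uK^-1) - (- uE * uK^-1) * (- uK * uF) =
  uK^-1 - uK).
rewrite !mulNr !mulrN !opprK !mulrA mulrVK ?uK_unit // -2!mulrA.
by rewrite [uF * _]mulrA mulrA uFE_comm_K -opprB uEF opprB.
Qed.

Lemma uz_comulM x y : uz_comul (x * y) = uz_comul x * uz_comul y.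
Proof. exact: (uz_liftM uz_comul_rels). Qed.
Lemma uz_comul1 : uz_comul 1 = 1.
Proof. exact: (uz_lift1 uz_comul_rels). Qed.
Lemma uz_comul_linear : linear uz_comul.
Proof. exact: (uz_lift_linear uz_comul_rels). Qed.
Lemma uz_comulE : uz_comul uE = uE ⊗ uK + 1 ⊗ uE.
Proof. exact: (uz_liftE uz_comul_rels). Qed.
Lemma uz_comulF : uz_comul uF = uK^-1 ⊗ uF + uF ⊗ 1.
Proof. exact: (uz_liftF uz_comul_rels). Qed.
Lemma uz_comulK : uz_comul uK = uK ⊗ uK.
Proof. exact: (uz_liftK uz_comul_rels). Qed.

Lemma uz_antipodeM x y : uz_antipode (x * y) = uz_antipode y * uz_antipode x.
Proof. exact: (uz_liftM uz_antipode_rels). Qed.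
Lemma uz_antipode1 : uz_antipode 1 = 1.
Proof. exact: (uz_lift1 uz_antipode_rels). Qed.
Lemma uz_antipode_linear : linear uz_antipode.
Proof. exact: (uz_lift_linear uz_antipode_rels). Qed.
Lemma uz_antipodeE : uz_antipode uE = - uE * uK^-1.
Proof. exact: (uz_liftE uz_antipode_rels). Qed.
Lemma uz_antipodeF : uz_antipode uF = - uK * uF.
Proof. exact: (uz_liftF uz_antipode_rels). Qed.
Lemma uz_antipodeK : uz_antipode uK = uK^-1.
Proof. exact: (uz_liftK uz_antipode_rels). Qed.

(* [qbrace n] is {n} and [qfall n k] is {n; k}. *)
Definition qbrace (n : int) : C := z ^ n - z ^ (- n).
Definition qint (n : int) : C := qbrace n / qbrace 1.
Definition qfact (n : nat) : C := \prod_(1 <= i < n.+1) qint i.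
Definition qfall (n k : int) : C :=
  \prod_(j <- irange 0 (k - 1)) qbrace (n - j).

(* The Laurent polynomial [k; l_1, ..., l_j]_q at q = zeta. Since
   [n]_q = q ^ (1 - n) * (1 + q^2 + ... + q^(2(n-1))), one has
   [n]_q! = q ^ (- 'C(n, 2)) * (qfact_poly n)(q). The polynomial quotient is
   exact; it has to be taken before specializing q, because quantum
   factorials vanish at zeta from r on. *)
Definition qmultinom (k : int) (l : seq int) : C :=
  let rest := k - \sum_(i <- l) i in
  if (0 <= k) && all (<=%R 0) l && (0 <= rest) then
    let d := [seq `|i|%N | i <- rcons l rest] in
    z ^ ((\sum_(i <- d) 'C(i, 2))%N%:Z - 'C(`|k|, 2)%:Z) *
    (map_poly intr (qfact_poly `|k| %/ \prod_(i <- d) qfact_poly i)).[z]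
  else 0.

Definition Epow (a : int) : uz := if 0 <= a then uE ^+ `|a| else 0.

Definition Fdiv (a : int) : uz :=
  if 0 <= a < r%:Z then (qfact `|a|)^-1 *: uF ^+ `|a| else 0.

Definition Tidem (a : int) : uz :=
  r%:R^-1 *: \sum_(b < r) z ^ (2 * a * b%:Z) *: uK ^+ b.

Definition Rmatrix : U2 :=
  \sum_(a < r) \sum_(b < r)
    z ^+ ((a * a.-1) %/ 2) *:
      ((uK ^- b * Epow a) ⊗ (Tidem b * Fdiv a)).

Definition drinfeld_elt : uz :=
  tens_lift (fun x y => uz_antipode y * x) Rmatrix.

Definition ribbon : uz := drinfeld_elt * uK^-1.

Let twist_inner (x y a b : uz) : U2 := (x * uz_antipode a) ⊗ (b * y).

Let twist_inner_bimap x y : bimap (twist_inner x y).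
Proof.
split=> [b|a] c u v; rewrite /twist_inner.
- by rewrite uz_antipode_linear mulrDr -scalerAr tpDl tpZl.
- by rewrite mulrDl -scalerAl tpDr tpZr.
Qed.

(* x ⊗ y |-> x S(w_(1)) ⊗ w_(2) y, where w is the inverse of the ribbon
   element. *)
Definition rho2_twist : U2 -> U2 :=
  tens_lift (fun x y =>
    tens_lift (fun a b => (x * uz_antipode a) ⊗ (b * y))
      (uz_comul ribbon^-1)).

Let twist_bimap :
  bimap (fun x y => tens_lift (twist_inner x y) (uz_comul ribbon^-1)).
Proof.
split=> [y|x].
- apply: (@tens_lift_fun_linear _ _ _ _ _ (twist_inner^~ y)) => a b c u v.
  by rewrite /= /twist_inner mulrDl -scalerAl tpDl tpZl.
- apply: (@tens_lift_fun_linear _ _ _ _ _ (twist_inner x)) => a b c u v.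
  by rewrite /twist_inner mulrDr -scalerAr tpDr tpZr.
Qed.

Lemma rho2_twist_linear : linear rho2_twist.
Proof. exact: tens_lift_linear twist_bimap. Qed.

Lemma rho2_twist_pure x y :
  rho2_twist (x ⊗ y) =
    tens_lift (fun a b => (x * uz_antipode a) ⊗ (b * y)) (uz_comul ribbon^-1).
Proof. exact: tens_lift_pure _ _ twist_bimap. Qed.

End SmallQuantumGroup.

(* Main.v *)
Require Import Defs.
From HB Require Import structures.
From mathcomp Require Import all_boot all_order all_algebra.
From mathcomp Require Import complex reals.
From mathcomp Require Import ring zify.

Set Implicit Arguments.
Unset Strict Implicit.
Unset Printing Implicit Defensive.

Import Order.TTheory GRing.Theory Num.Theory.
Local Open Scope ring_scope.

(** The inverse of the ribbon element is w = sum_n zeta^(n(n-1)/2) F^(n) G K^-n E^n,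
    where G acts on T_m by zeta^(2m(m-1)). Since w commutes with the generators,
    it can be moved to the middle of each summand of v w, which leaves the
    coefficients sum_b (-1)^b zeta^(-(N-1)b) / ([b]![N-b]!) of F^N E^N; they
    vanish for 0 < N < r. Expanding Delta(w) by the q-binomial theorem turns the
    twist of x ⊗ y into a sum of terms x E^p F^(s) ⊗ F^(t) E^k y with
    p + k = s + t = n, because the Cartan part acts by scalars on the weight
    vectors x and y. It remains to move the powers of E to the left of those
    of F and to reindex by j1 + i1 = p, k2 = k, b = t - k. *)

(** The algebra is a quotient of formal expressions, so equalities in it are tested weight by
    weight: the [T m] sum to 1 ([sum_Tidem]), hence [x] and [y] are equal once [x * T m = y * T m]
    for all [m] ([eq_mulTidem]). Next to [T m] the powers of [K] and the element G become powers of
    zeta, and identities in the algebra turn into scalar ones. Oddness of [r] gives [z ^+ 2] the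
    exact order [r]. This makes the [T m] orthogonal idempotents and makes the quantum integers 1,
    ..., [r - 1] invertible; from [r] on, quantum factorials vanish at zeta. The upper entries of
    the binomials can reach [r], so a binomial is identified while it is still a quotient of
    polynomials, and only factorials of lower entries below [r] are ever inverted. The closed form
    of w is verified to be the inverse of [ribbon] on the nose, and all later coefficients are
    tracked exactly, so the scalar of proportionality comes out as 1. *)

Lemma big_irange (T : Type) (op : T -> T -> T) (idx : T) (a b : int) (n : nat)
    (f : int -> T) : b = a + n%:Z - 1 ->
  \big[op/idx]_(x <- irange a b) f x = \big[op/idx]_(i < n) f (a + i%:Z).
Proof.
move=> ->; rewrite /irange big_map.
have -> : (if a <= a + n%:Z - 1 then (absz (a + n%:Z - 1 - a)%R).+1 else 0%N) = n.
  by case: ifP; lia.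
by rewrite -[X in iota _ X]subn0 -/(index_iota 0 n) big_mkord.
Qed.

(** The triangle [i + j < n] summed by antidiagonals and by rows; the induction step adds the last
    antidiagonal, one new point per row. *)
Lemma sum_triangle (V : nmodType) (n : nat) (f : nat -> nat -> V) :
  \sum_(m < n) \sum_(k < m.+1) f k (m - k)%N =
    \sum_(i < n) \sum_(j < n - i) f i j.
Proof.
elim: n => [|n IH]; first by rewrite !big_ord0.
rewrite big_ord_recr /= IH [RHS]big_ord_recr /= subSnn big_ord1.
rewrite big_ord_recr /= subnn addrA -big_split /=; congr (_ + _).
apply: eq_bigr => i _; rewrite subSn ?big_ord_recr //=; exact: ltnW.
Qed.

(** A cyclic shift of the index. It serves when [f] is periodic, as for powers of [K], and when both
    boundary terms vanish, as in the commutation of [ribbon_inv] with [E] and [F]. *)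
Lemma sum_ordS (V : nmodType) (f : nat -> V) n :
  f n = f 0%N -> \sum_(i < n) f i.+1 = \sum_(i < n) f i.
Proof.
case: n => [|n] fn; first by rewrite !big_ord0.
by rewrite big_ord_recr big_ord_recl /= fn addrC.
Qed.

Lemma sum_ord_trunc (V : nmodType) (f : nat -> V) m n : (n <= m)%N ->
  (forall j, (n <= j < m)%N -> f j = 0) -> \sum_(j < m) f j = \sum_(j < n) f j.
Proof.
move=> nm f0; rewrite -!(big_mkord xpredT f) (@big_cat_nat _ _ _ n) //=.
by rewrite big_nat [X in _ + X]big_nat [X in _ + X]big1 ?addr0 // -big_nat.
Qed.

Lemma sum_ord_rev (V : nmodType) (f : nat -> V) n :
  \sum_(c < n.+1) f c = \sum_(c < n.+1) f (n - c)%N.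
Proof.
by rewrite (reindex_inj rev_ord_inj); apply: eq_bigr => c _; rewrite /= subSS.
Qed.

(** * Quantum integers and multinomials at zeta *)

(** The top [c] factors of [qfact_poly m]: a polynomial substitute for the ratio of two factorials,
    whose values at zeta may both be 0. *)
Definition qfall_poly (m c : nat) : {poly int} :=
  \prod_(i < c) \sum_(j < m - i) 'X^(2 * j).

Lemma qfact_polyS n :
  qfact_poly n.+1 = qfact_poly n * \sum_(i < n.+1) 'X^(2 * i).
Proof. by rewrite /qfact_poly big_nat_recr. Qed.

Lemma qfall_polyE m c : (c <= m)%N ->
  qfact_poly m = qfact_poly (m - c) * qfall_poly m c.
Proof.
elim: c => [|c IH] cm; first by rewrite subn0 /qfall_poly big_ord0 mulr1.
rewrite IH ?(ltnW cm) // /qfall_poly big_ord_recr /= -subSS subSn //.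
by rewrite qfact_polyS -subSn // subSS mulrA mulrAC.
Qed.

(** Over the integers, the polynomial quotient in [qmultinom] cancels exactly because its divisor is
    monic. *)
Lemma qfact_poly_monic n : qfact_poly n \is monic.
Proof.
elim: n => [|n IH]; first by rewrite /qfact_poly big_nil monic1.
rewrite qfact_polyS rpredM // big_ord_recr /= addrC; apply/monicP.
rewrite lead_coefDl ?lead_coefXn // size_polyXn ltnS.
apply: leq_trans (size_sum _ _ _) _; apply/bigmax_leqP => i _.
by rewrite size_polyXn; have := ltn_ord i; lia.
Qed.

(** The q-Pascal rule, by strong induction on [a + b]: the last factor of the factorial of
    [a.+1 + b.+1] splits as the factor of [a.+1] plus ['X^(2 * a.+1)] times the factor of [b.+1]. *)
Lemma qfact_poly_dvd a b :
  exists g, qfact_poly (a + b) = g * (qfact_poly a * qfact_poly b).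
Proof.
have [n] := ubnP (a + b)%N; elim: n a b => // n IH [|a] [|b] abn.
- by exists 1; rewrite mul1r /qfact_poly big_nil mulr1.
- by exists 1; rewrite add0n {2}/qfact_poly big_nil !mul1r.
- by exists 1; rewrite addn0 {3}/qfact_poly big_nil mulr1 mul1r.
have [g1 E1] := IH a b.+1 ltac:(lia).
have [g2 E2] := IH a.+1 b ltac:(lia).
exists (g1 + 'X^(2 * a.+1) * g2).
have -> : (a.+1 + b.+1 = (a + b.+1).+1)%N by lia.
rewrite qfact_polyS.
have -> : \sum_(i < (a + b.+1).+1) 'X^(2 * i) =
   \sum_(i < a.+1) 'X^(2 * i) + 'X^(2 * a.+1) * \sum_(i < b.+1) 'X^(2 * i)
     :> {poly int}.
  rewrite -(big_mkord xpredT (fun i => 'X^(2 * i) : {poly int})).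
  rewrite (@big_cat_nat _ _ _ a.+1) //=; last by lia.
  rewrite big_mkord mulr_sumr -[X in index_iota X _]add0n big_addn.
  have -> : ((a + b.+1).+1 - a.+1 = b.+1)%N by lia.
  rewrite big_mkord; congr (_ + _); apply: eq_bigr => i _.
  by rewrite -exprD mulnDr addnC.
rewrite mulrDr {1}E1.
have -> : (a + b.+1 = a.+1 + b)%N by lia.
rewrite E2 !qfact_polyS; ring.
Qed.

(* Locked because [Tidem] and [Fdiv] unfold to scalings, which the scaling and
   associativity lemmas would otherwise match inside them. *)
HB.lock Definition idem (R : realType) (r : oddlevel) (m : int) : uz R r :=
  Tidem R r m.

HB.lock Definition fdiv (R : realType) (r : oddlevel) (n : nat) : uz R r :=
  (qfact R r n)^-1 *: uF R r ^+ n.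

Section SmallQuantumGroup.
Variables (R : realType) (r : oddlevel).
Local Notation C := R[i].
Local Notation z := (zeta R r).
Local Notation brace := (qbrace R r).
Local Notation qi := (qint R r).
Local Notation qf := (qfact R r).
Local Notation E := (uE R r).
Local Notation F := (uF R r).
Local Notation K := (uK R r).
Local Notation T := (idem R r).
Local Notation Fd := (fdiv R r).
Local Notation uz := (uz R r).
Local Notation U2 := (tens uz uz).
Local Notation S := (@uz_antipode R r).

Lemma zetaD m n : z ^ (m + n) = z ^ m * z ^ n.
Proof. by rewrite expfzDr ?zeta_neq0. Qed.

Lemma zetaN m : z ^ (- m) = (z ^ m)^-1.
Proof. by rewrite -invr_expz. Qed.

Lemma zeta_period (m n k : int) : m = n + r%:Z * k -> z ^ m = z ^ n.
Proof.
by move=> ->; rewrite zetaD -exprz_exp -exprnP zeta_exp1 exp1rz mulr1.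
Qed.

Lemma zetaz_neq0 m : z ^ m != 0.
Proof. by rewrite expfz_neq0 ?zeta_neq0. Qed.

Lemma zeta2_neq1 (d : int) : ~~ (r%:Z %| d)%Z -> z ^ (2 * d) != 1.
Proof.
move=> rd; have r0 := level_gt0 r.
have md : 0 <= (d %% r%:Z)%Z by rewrite modz_ge0 // eqz_nat -lt0n.
have ml : (d %% r%:Z)%Z < r%:Z by rewrite ltz_pmod.
have m0 : (d %% r%:Z)%Z != 0 by apply: contra rd => /eqP/dvdz_mod0P.
have -> : z ^ (2 * d) = (z ^+ 2) ^+ `|(d %% r%:Z)%Z|%N.
  rewrite -exprM exprnP PoszM gez0_abs //.
  apply: (@zeta_period _ _ (2 * (d %/ r%:Z)%Z)).
  by rewrite {1}(divz_eq d r%:Z); ring.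
apply: zeta2_exp_neq1; move: md ml m0; case: (d %% r%:Z)%Z => // n; lia.
Qed.

Lemma qbraceE n : brace n = z ^ (- n) * (z ^ (2 * n) - 1).
Proof.
by rewrite mulrBr mulr1 -zetaD /qbrace; congr (z ^ _ - _); ring.
Qed.

Lemma qbrace_neq0 (n : int) : ~~ (r%:Z %| n)%Z -> brace n != 0.
Proof.
by move=> rn; rewrite qbraceE mulf_neq0 ?zetaz_neq0 // subr_eq0 zeta2_neq1.
Qed.

Lemma qbrace1_neq0 : brace 1 != 0.
Proof. by apply: qbrace_neq0; rewrite dvdz1; have := level_ge3 r; lia. Qed.

Lemma qint_neq0 (n : nat) : (0 < n < r)%N -> qi n != 0.
Proof.
move=> nr; rewrite mulf_neq0 ?invr_eq0 ?qbrace1_neq0 // qbrace_neq0 //.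
by rewrite dvdzE /= gtnNdvd //; case/andP: nr.
Qed.

Lemma qint0 : qi 0 = 0.
Proof. by rewrite /qint /qbrace oppr0 subrr mul0r. Qed.

Lemma qint1 : qi 1 = 1.
Proof. by rewrite /qint divff ?qbrace1_neq0. Qed.

Lemma qfact0 : qf 0 = 1.
Proof. by rewrite /qfact big_nil. Qed.

Lemma qfactS n : qf n.+1 = qf n * qi n.+1%:Z.
Proof. by rewrite /qfact big_nat_recr. Qed.

Lemma qfact_neq0 n : (n < r)%N -> qf n != 0.
Proof.
elim: n => [|n IH] nr; first by rewrite qfact0 oner_eq0.
by rewrite qfactS mulf_neq0 ?IH ?qint_neq0 // ltnW.
Qed.

Lemma qbrace_mul (a c t : int) :
  brace (a - c) * brace (t - c) + brace c * brace (a + t - c) =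
    brace t * brace a.
Proof.
rewrite /qbrace !opprB !(zetaD, zetaN, opprD, opprK).
by field; rewrite !zetaz_neq0.
Qed.

(** The recursion behind the commutation formulas: [c = 1] advances the power of [E] in [Tidem_uFE],
    general [c] the power of [F] in [Tidem_Fd_uE]. *)
Lemma qint_mul (a c t : int) :
  qi (t - c) * brace (a - c) + qi c * brace (a + t - c) = qi t * brace a.
Proof.
rewrite /qint ![_ / _ * _]mulrAC -mulrDl -(qbrace_mul a c).
by rewrite [brace (t - c) * _]mulrC.
Qed.

Lemma qintD (a b : int) : qi (a + b) = z ^ b * qi a + z ^ (- a) * qi b.
Proof.
rewrite /qint !mulrA -mulrDl; congr (_ / _).
rewrite /qbrace opprD !(zetaD, zetaN); field; rewrite !zetaz_neq0 //.
Qed.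

(** Written as a falling product over [qf c], so that it is the right value for [c < r] and every
    [m]; with three factorials it would degenerate to 0 over 0 for large [m]. *)
Definition qbin (m c : nat) : C := (\prod_(i < c) qi (m%:Z - i%:Z)) / qf c.

Lemma qbin0 m : qbin m 0 = 1.
Proof. by rewrite /qbin big_ord0 qfact0 divr1. Qed.

Lemma qbin_small m c : (m < c)%N -> qbin m c = 0.
Proof.
by move=> mc; rewrite /qbin (bigD1 (Ordinal mc)) //= subrr qint0 !mul0r.
Qed.

Lemma qbinS m c : (c.+1 < r)%N ->
  qbin m c.+1 * qi c.+1%:Z = qbin m c * qi (m%:Z - c%:Z).
Proof.
move=> cr; rewrite /qbin big_ord_recr /= qfactS.
have := qfact_neq0 (ltnW cr); have := @qint_neq0 c.+1 cr.
by move=> h1 h2; field; apply/andP.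
Qed.

Lemma qfact_falling m c : (c <= m)%N ->
  qf m = qf (m - c) * \prod_(i < c) qi (m%:Z - i%:Z).
Proof.
elim: c => [|c IH] cm; first by rewrite subn0 big_ord0 mulr1.
rewrite IH ?(ltnW cm) // big_ord_recr /=.
have -> : (m - c = (m - c.+1).+1)%N by lia.
rewrite qfactS.
have -> : (m - c.+1).+1%:Z = m%:Z - c%:Z by lia.
by rewrite mulrA mulrAC.
Qed.

Lemma qbinE m c : (c <= m < r)%N -> qbin m c = qf m / (qf c * qf (m - c)).
Proof.
move=> /andP[cm mr]; rewrite (qfact_falling cm) /qbin.
have h1 : qf c != 0 by rewrite qfact_neq0 //; lia.
have h2 : qf (m - c) != 0 by rewrite qfact_neq0 //; lia.
by field; apply/andP.
Qed.

Lemma bin2_double n : ('C(n, 2)%:Z * 2 = n%:Z * (n%:Z - 1)).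
Proof.
elim: n => [|n IH] //; rewrite binS bin1 PoszD mulrDl IH; lia.
Qed.

Lemma one_sub_zeta2 (n : nat) : 1 - (z ^+ 2) ^+ n = - z ^ n%:Z * brace n.
Proof.
rewrite qbraceE !mulrA mulNr -zetaD subrr expr0z mulN1r opprB -exprM.
by rewrite exprnP PoszM.
Qed.

(** Each factor [1 - (z ^+ 2) ^+ n] is [- z ^ n * brace n], so both products in [gauss_binomE]
    become products of quantum integers; the surplus powers of [z] amount to [k * (n - k)]. *)
Lemma gauss_binom_qbin n k : (k <= n < r)%N ->
  gauss_binom (z ^+ 2) n k = z ^ (k%:Z * (n%:Z - k%:Z)) * qbin n k.
Proof.
move=> knr; have kr : (k < r)%N by lia.
have brE m : brace m = qi m * brace 1 by rewrite /qint divfK ?qbrace1_neq0.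
have P1 j : (j <= k)%N -> \prod_(i < j) (1 - (z ^+ 2) ^+ i.+1) =
    (- brace 1) ^+ j * z ^ ('C(j, 2)%:Z + j%:Z) * qf j.
  elim: j => [|j IH] jk; first by rewrite big_ord0 qfact0 !mulr1.
  rewrite big_ord_recr /= IH ?(ltnW jk) // one_sub_zeta2 (brE j.+1) qfactS exprS.
  have -> : 'C(j.+1, 2)%:Z + j.+1%:Z = 'C(j, 2)%:Z + j%:Z + j.+1%:Z.
    by rewrite binS bin1; lia.
  by rewrite [in RHS]zetaD; ring.
have P2 j : (j <= k)%N -> \prod_(i < j) (1 - (z ^+ 2) ^+ (n - i)) =
    (- brace 1) ^+ j * z ^ (j%:Z * n%:Z - 'C(j, 2)%:Z) *
    \prod_(i < j) qi (n%:Z - i%:Z).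
  elim: j => [|j IH] jk; first by rewrite !big_ord0 !mulr1.
  rewrite !big_ord_recr /= IH ?(ltnW jk) // one_sub_zeta2 (brE (n - j)%N) exprS.
  have -> : j.+1%:Z * n%:Z - 'C(j.+1, 2)%:Z =
      j%:Z * n%:Z - 'C(j, 2)%:Z + (n%:Z - j%:Z).
    by rewrite binS bin1; lia.
  have -> : (n - j)%:Z = n%:Z - j%:Z by rewrite -subzn //; lia.
  by rewrite [in RHS]zetaD; ring.
have := gauss_binomE (z ^+ 2) n k; rewrite P1 // P2 // => E.
have nz : (- brace 1) ^+ k * z ^ ('C(k, 2)%:Z + k%:Z) * qf k != 0.
  apply: mulf_neq0; last exact: qfact_neq0.
  apply: mulf_neq0; last exact: zetaz_neq0.
  by rewrite expf_neq0 // oppr_eq0 qbrace1_neq0.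
apply: (mulIf nz); rewrite E /qbin.
have -> : k%:Z * n%:Z - 'C(k, 2)%:Z =
    k%:Z * (n%:Z - k%:Z) + ('C(k, 2)%:Z + k%:Z).
  by have := bin2_double k; lia.
rewrite [in LHS]zetaD; field; exact: qfact_neq0.
Qed.

(* Multiplying by [n] = zeta^(n-k) [k] + zeta^(-k) [n-k] makes the sum telescope. *)
Lemma qfact_alternating n : (0 < n < r)%N ->
  \sum_(k < n.+1) (-1) ^+ k * z ^ (- (n%:Z - 1) * k%:Z) / (qf k * qf (n - k))
    = 0.
Proof.
case: n => [//|n] /andP[_ nr].
pose t k := (-1) ^+ k * z ^ (- (n.+1%:Z - 1) * k%:Z) / (qf k * qf (n.+1 - k)).
pose g k := t k * (z ^ (- k%:Z) * qi (n.+1%:Z - k%:Z)).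
pose h k := t k * (z ^ (n.+1%:Z - k%:Z) * qi k%:Z).
have hS k : (k < n.+1)%N -> h k.+1 = - g k.
  move=> kn; rewrite /h /g /t subSS subSn // !qfactS exprS.
  have -> : (n - k).+1%:Z = n.+1%:Z - k%:Z by lia.
  have i1 : qi (n.+1%:Z - k%:Z) != 0.
    by rewrite (_ : _ - _ = (n.+1 - k)%N%:Z) ?qint_neq0; lia.
  have i2 : qi k.+1%:Z != 0 by rewrite qint_neq0; lia.
  have i3 : qf k != 0 by rewrite qfact_neq0; lia.
  have i4 : qf (n - k) != 0 by rewrite qfact_neq0; lia.
  have -> : z ^ (- (n.+1%:Z - 1) * k.+1%:Z) =
      z ^ (- (n.+1%:Z - 1) * k%:Z) * z ^ (- k%:Z) / z ^ (n.+1%:Z - k.+1%:Z).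
    by rewrite -zetaN -!zetaD; congr (z ^ _); lia.
  by field; rewrite zetaz_neq0 i1 i2 i3 i4.
apply: (mulfI (qint_neq0 (ltac:(lia) : (0 < n.+1 < r)%N))).
rewrite mulr0 mulr_sumr (eq_bigr (fun k : 'I_n.+2 => g k + h k)); last first.
  move=> k _; rewrite -mulrDr mulrC; congr (_ * _).
  by rewrite addrC -qintD; congr (qi _); lia.
rewrite big_split /= big_ord_recr [X in _ + X]big_ord_recl /=.
have -> : g n.+1 = 0 by rewrite /g subrr qint0 !mulr0.
have -> : h 0%N = 0 by rewrite /h qint0 !mulr0.
rewrite addr0 add0r -big_split.
by apply: big1 => k _; rewrite /= hS ?addrN.
Qed.

(** * Evaluation at zeta of the polynomial factorials and multinomials *)

Local Notation ev p := (map_poly intr p).[z].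

Lemma horner_qnum (m : nat) :
  ev (\sum_(j < m) 'X^(2 * j) : {poly int}) = z ^ (m%:Z - 1) * qi m%:Z.
Proof.
elim: m => [|m IH]; first by rewrite big_ord0 rmorph0 horner0 qint0 mulr0.
rewrite big_ord_recr /= rmorphD hornerD IH /= map_polyXn hornerXn.
have -> : m.+1%:Z = 1 + m%:Z by lia.
rewrite qintD qint1 mulr1 mulrDr -!zetaD mulrA -zetaD addrC exprnP.
by congr (z ^ _ + z ^ _ * _); lia.
Qed.

Lemma horner_qfact n : ev (qfact_poly n) = z ^ 'C(n, 2)%:Z * qf n.
Proof.
elim: n => [|n IH].
  by rewrite /qfact_poly big_nil rmorph1 hornerC qfact0 mulr1.
rewrite qfact_polyS rmorphM hornerM IH horner_qnum qfactS.
have -> : 'C(n.+1, 2)%:Z = 'C(n, 2)%:Z + (n.+1%:Z - 1).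
  by rewrite binS bin1; lia.
by rewrite [in RHS]zetaD; ring.
Qed.

Lemma horner_qfall m c : (c <= m)%N ->
  ev (qfall_poly m c) =
    z ^ ('C(m, 2)%:Z - 'C(m - c, 2)%:Z) * \prod_(i < c) qi (m%:Z - i%:Z).
Proof.
elim: c => [|c IH] cm.
  by rewrite /qfall_poly !big_ord0 rmorph1 hornerC subn0 subrr mulr1.
rewrite /qfall_poly !big_ord_recr /= rmorphM hornerM -/(qfall_poly m c).
rewrite IH ?horner_qnum; last by lia.
have -> : (m - c)%:Z = m%:Z - c%:Z by lia.
have -> : 'C(m, 2)%:Z - 'C(m - c.+1, 2)%:Z =
    ('C(m, 2)%:Z - 'C(m - c, 2)%:Z) + (m%:Z - c%:Z - 1).
  have -> : (m - c = (m - c.+1).+1)%N by lia.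
  by rewrite binS bin1; lia.
by rewrite [in RHS]zetaD; ring.
Qed.

(** For [m >= r] the factorial of [m] vanishes at zeta, and that of [m - c] may vanish too. The
    latter is therefore cancelled as a monic polynomial, and evaluation only has to divide by the
    factorial of [c], which is nonzero. *)
Lemma qmultinom1 (m c : nat) : (c < r)%N ->
  qmultinom R r m%:Z [:: c%:Z] = qbin m c.
Proof.
move=> cr; rewrite /qmultinom big_seq1 /=.
have [cm|mc] := leqP c m; last by rewrite qbin_small // ifF //; lia.
rewrite ifT; last by lia.
have -> : `|m%:Z - c%:Z|%N = (m - c)%N by lia.
rewrite !big_cons !big_nil !(addn0, mulr1).
have [g Eg] := qfact_poly_dvd c (m - c).
rewrite subnKC // in Eg; rewrite Eg Pdiv.IdomainMonic.mulpK; last first.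
  by rewrite monicMl ?qfact_poly_monic.
have Eg' : qfall_poly m c = g * qfact_poly c.
  apply: (mulIf (monic_neq0 (qfact_poly_monic (m - c)))).
  by rewrite -mulrA -Eg (qfall_polyE cm) mulrC.
have := congr1 (fun p => ev p) Eg'.
rewrite /= rmorphM hornerM horner_qfall // horner_qfact => E.
rewrite /qbin.
apply: (mulIf (mulf_neq0 (zetaz_neq0 'C(c, 2)%:Z) (qfact_neq0 cr))).
rewrite -mulrA -E [LHS]mulrA -zetaD.
have -> : ('C(c, 2) + 'C(m - c, 2))%N%:Z - 'C(m, 2)%:Z +
   ('C(m, 2)%:Z - 'C(m - c, 2)%:Z) = 'C(c, 2)%:Z by lia.
by field; exact: qfact_neq0.
Qed.

(** The right-hand side has the shape in which the coefficient arises: the first binomial comes from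
    the coproduct of [E ^+ (i + j + k)], the second from [left_factor]. Below [r] no factorial
    vanishes. *)
Lemma qmultinom2 (i j k : nat) : (i + j + k < r)%N ->
  qmultinom R r (i%:Z + j%:Z + k%:Z) [:: i%:Z; j%:Z] =
    qbin (i + j + k) k * qbin (i + j) i.
Proof.
move=> nr; rewrite /qmultinom !big_cons big_nil addr0 /= ifT; last by lia.
have -> : i%:Z + j%:Z + k%:Z - (i%:Z + j%:Z) = k%:Z by lia.
rewrite !big_nil !(addn0, mulr1) /=.
have [g1 E1] := qfact_poly_dvd i (j + k).
have [g2 E2] := qfact_poly_dvd j k.
have Eg : qfact_poly (i + j + k) =
    g1 * g2 * (qfact_poly i * (qfact_poly j * qfact_poly k)).
  by rewrite -addnA E1 E2; ring.
rewrite Eg Pdiv.IdomainMonic.mulpK; last first.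
  by rewrite !monicMl ?qfact_poly_monic.
have := congr1 (fun p => ev p) Eg.
rewrite /= (rmorphM _ (g1 * g2)) hornerM (rmorphM _ (qfact_poly i)) hornerM.
rewrite (rmorphM _ (qfact_poly j)) hornerM !horner_qfact => E.
rewrite !qbinE; try lia.
have -> : (i + j + k - k = i + j)%N by lia.
have -> : (i + j - i = j)%N by lia.
have hi : qf i != 0 by rewrite qfact_neq0; lia.
have hj : qf j != 0 by rewrite qfact_neq0; lia.
have hk : qf k != 0 by rewrite qfact_neq0; lia.
have hij : qf (i + j) != 0 by rewrite qfact_neq0; lia.
have nz : z ^ 'C(i, 2)%:Z * z ^ 'C(j, 2)%:Z * z ^ 'C(k, 2)%:Z *
    (qf i * qf j * qf k) != 0 by rewrite !mulf_neq0 ?zetaz_neq0.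
apply: (mulIf nz).
rewrite [z ^ (_ - _)]zetaD zetaN !PoszD !zetaD.
set G := (map_poly _ _).[_] in E *.
have -> : qf (i + j + k) = (z ^ 'C(i + j + k, 2)%:Z)^-1 *
   (G * (z ^ 'C(i, 2) * qf i * (z ^ 'C(j, 2) * qf j * (z ^ 'C(k, 2) * qf k)))).
  by rewrite -E mulKf // zetaz_neq0.
by field; rewrite zetaz_neq0 hi hj hk hij.
Qed.

Lemma qfall_nat (n : int) (k : nat) :
  qfall R r n k%:Z = \prod_(j < k) brace (n - j%:Z).
Proof.
by rewrite /qfall (@big_irange _ _ _ _ _ k) ?add0r //.
Qed.
Lemma idemE m : T m = Tidem R r m. Proof. by rewrite idem.unlock. Qed.

Lemma fdivE n : Fd n = (qf n)^-1 *: F ^+ n. Proof. by rewrite fdiv.unlock. Qed.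

(** * Weight idempotents and commutation relations *)

Lemma sum_zeta (d : int) :
  r%:R^-1 * \sum_(b < r) z ^ (2 * d * b%:Z) = (r%:Z %| d)%Z%:R.
Proof.
have r0 : (r%:R : C) != 0 by rewrite pnatr_eq0 -lt0n level_gt0.
have [/dvdzP[q ->]|rd] := boolP (r%:Z %| d)%Z.
  rewrite (eq_bigr (fun _ => 1)) => [|b _].
    by rewrite sumr_const card_ord mulVf.
  by rewrite (@zeta_period _ 0 (2 * q * b%:Z)) //; ring.
have := zeta2_neq1 rd; rewrite -subr_eq0 => nz.
apply/eqP; rewrite mulf_eq0 invr_eq0 (negbTE r0) /=.
rewrite -(mulrI_eq0 _ (mulfI nz)); apply/eqP.
rewrite (eq_bigr (fun b : 'I_r => (z ^ (2 * d)) ^+ b)) => [|b _].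
  rewrite -subrX1 exprnP exprz_exp (@zeta_period _ 0 (2 * d)) ?subrr //.
  by ring.
by rewrite exprnP exprz_exp.
Qed.

(** Cartan elements are sums over residues modulo [r], but weights are arbitrary integers; the
    surviving index is [m %% r], and periodicity of [h] brings its value back to [m]. *)
Lemma sum_period_delta (h : int -> C) (m : int) :
  (forall a k, h (a + r%:Z * k) = h a) ->
  \sum_(a < r) h a%:Z * (r%:Z %| a%:Z - m)%Z%:R = h m.
Proof.
move=> per; have r0 := level_gt0 r.
have md : 0 <= (m %% r%:Z)%Z by rewrite modz_ge0 // eqz_nat -lt0n.
have ml : (m %% r%:Z)%Z < r%:Z by rewrite ltz_pmod.
have mr : (`|(m %% r%:Z)%Z| < r)%N by move: md ml; lia.
have mE : (`|(m %% r%:Z)%Z|%N)%:Z = (m %% r%:Z)%Z by rewrite gez0_abs.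
rewrite (bigD1 (Ordinal mr)) //= mE big1 ?addr0 => [|a].
  have dm := divz_eq m r%:Z.
  rewrite -[in RHS](_ : (m %% r%:Z)%Z + r%:Z * (m %/ r%:Z)%Z = m); last first.
    by rewrite {3}dm; ring.
  rewrite per [X in (_ %| X)%Z](_ : _ = - (m %/ r%:Z)%Z * r%:Z).
    by rewrite dvdz_mull // mulr1.
  by rewrite {2}dm; ring.
rewrite -val_eqE /= => am; case: dvdzP => [[q Eq]|]; last by rewrite mulr0.
case/eqP: am; apply/eqP; rewrite -eqz_nat mE; apply/eqP.
have -> : m = - q * r%:Z + a%:Z by lia.
by rewrite modzMDl modz_small //; have := ltn_ord a; lia.
Qed.

Lemma uKTidem m : K * T m = z ^ (- (2 * m)) *: T m.
Proof.
rewrite !idemE /Tidem -scalerAr scalerA [_ * _^-1]mulrC -scalerA; congr (_ *: _).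
rewrite mulr_sumr scaler_sumr.
pose f i := z ^ (2 * m * i%:Z - 2 * m) *: K ^+ i.
rewrite (eq_bigr (fun b : 'I_r => f b.+1)) => [|b _].
  rewrite sum_ordS; first by apply: eq_bigr => b _; rewrite scalerA -zetaD addrC.
  have [_ _ Kr _] := uz_relsP R r; rewrite /f Kr expr0; congr (_ *: _).
  by apply: (@zeta_period _ _ (2 * m)); ring.
by rewrite -scalerAr -exprS; congr (z ^ _ *: _); lia.
Qed.

Lemma Tidem_comm_uK m : T m * K = K * T m.
Proof.
rewrite !idemE /Tidem -scalerAl -scalerAr; congr (_ *: _).
rewrite mulr_suml mulr_sumr; apply: eq_bigr => b _.
by rewrite -scalerAl -scalerAr -exprS -exprSr.
Qed.

Lemma TidemK m : T m * K = z ^ (- (2 * m)) *: T m.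
Proof. by rewrite Tidem_comm_uK uKTidem. Qed.

Lemma uKXTidem m n : K ^+ n * T m = z ^ (- (2 * m * n%:Z)) *: T m.
Proof.
elim: n => [|n IH]; first by rewrite mul1r mulr0 oppr0 expr0z scale1r.
rewrite exprSr -mulrA uKTidem -scalerAr IH scalerA -zetaD.
by congr (z ^ _ *: _); lia.
Qed.

Lemma TidemKX m n : T m * K ^+ n = z ^ (- (2 * m * n%:Z)) *: T m.
Proof.
elim: n => [|n IH]; first by rewrite mulr1 mulr0 oppr0 expr0z scale1r.
rewrite exprS mulrA TidemK -scalerAl IH scalerA -zetaD.
by congr (z ^ _ *: _); lia.
Qed.

Lemma uKVTidem m n : K ^- n * T m = z ^ (2 * m * n%:Z) *: T m.
Proof.
apply: (mulrI (unitrX n (uK_unit R r))); rewrite mulVKr ?unitrX ?uK_unit //.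
by rewrite -scalerAr uKXTidem scalerA -zetaD addrN scale1r.
Qed.

Lemma TidemKV m n : T m * K ^- n = z ^ (2 * m * n%:Z) *: T m.
Proof.
apply: (mulIr (unitrX n (uK_unit R r))); rewrite mulrVK ?unitrX ?uK_unit //.
by rewrite -scalerAl TidemKX scalerA -zetaD addrN scale1r.
Qed.

Lemma uKXE n : K ^+ n * E = z ^ (2 * n%:Z) *: (E * K ^+ n).
Proof.
elim: n => [|n IH]; first by rewrite mul1r mulr1 scale1r.
rewrite exprSr -mulrA uKE -scalerAr [in LHS]mulrA IH -scalerAl scalerA.
by rewrite [in RHS]mulrA [z ^+ 2]exprnP -zetaD; congr (z ^ _ *: _); lia.
Qed.

Lemma uKXF n : K ^+ n * F = z ^ (- (2 * n%:Z)) *: (F * K ^+ n).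
Proof.
elim: n => [|n IH]; first by rewrite mul1r mulr1 scale1r.
rewrite exprSr -mulrA uKF -scalerAr [in LHS]mulrA IH -scalerAl scalerA.
by rewrite [in RHS]mulrA exprnN -zetaD; congr (z ^ _ *: _); lia.
Qed.

Lemma TidemE m : T m * E = E * T (m + 1).
Proof.
rewrite !idemE /Tidem -scalerAl -scalerAr; congr (_ *: _).
rewrite mulr_suml mulr_sumr; apply: eq_bigr => b _.
rewrite -scalerAl -scalerAr uKXE scalerA -zetaD.
by congr (z ^ _ *: _); lia.
Qed.

Lemma TidemF m : T m * F = F * T (m - 1).
Proof.
rewrite !idemE /Tidem -scalerAl -scalerAr; congr (_ *: _).
rewrite mulr_suml mulr_sumr; apply: eq_bigr => b _.
rewrite -scalerAl -scalerAr uKXF scalerA -zetaD.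
by congr (z ^ _ *: _); lia.
Qed.

Lemma TidemEX m n : T m * E ^+ n = E ^+ n * T (m + n%:Z).
Proof.
elim: n m => [|n IH] m; first by rewrite mul1r mulr1 addr0.
rewrite exprS mulrA TidemE -mulrA IH mulrA; congr (_ * T _); lia.
Qed.

Lemma TidemFX m n : T m * F ^+ n = F ^+ n * T (m - n%:Z).
Proof.
elim: n m => [|n IH] m; first by rewrite mul1r mulr1 subr0.
rewrite exprS mulrA TidemF -mulrA IH mulrA; congr (_ * T _); lia.
Qed.

Lemma Tidem_mul a m : T a * T m = (r%:Z %| a - m)%Z%:R *: T m.
Proof.
rewrite [T a]idemE /Tidem -scalerAl mulr_suml.
rewrite (eq_bigr (fun b : 'I_r => z ^ (2 * (a - m) * b%:Z) *: T m)) => [|b _].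
  by rewrite -scaler_suml scalerA sum_zeta.
by rewrite -scalerAl uKXTidem scalerA -zetaD; congr (z ^ _ *: _); lia.
Qed.

Lemma sum_Tidem : \sum_(m < r) T m%:Z = 1.
Proof.
under eq_bigr do rewrite idemE.
rewrite /Tidem -scaler_sumr exchange_big /= scaler_sumr.
have r0 := level_gt0 r.
rewrite (eq_bigr (fun b : 'I_r => (r%:Z %| b%:Z)%Z%:R *: K ^+ b)) => [|b _].
  rewrite (bigD1 (Ordinal r0)) //= big1 ?addr0 => [|b].
    by rewrite dvdz0 scale1r.
  rewrite -val_eqE /= => b0.
  by rewrite dvdzE /= gtnNdvd ?scale0r ?lt0n.
rewrite -sum_zeta -scaler_suml scalerA; congr ((_ * _) *: _).
by apply: eq_bigr => m _; congr (z ^ _); lia.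
Qed.

Lemma eq_mulTidem (x y : uz) : (forall m, x * T m = y * T m) -> x = y.
Proof.
move=> xy; rewrite -[x]mulr1 -[y]mulr1 -sum_Tidem !mulr_sumr.
by apply: eq_bigr => m _.
Qed.

(** * Divided powers and the exchange of E and F *)

Lemma uF_nilp n : (r <= n)%N -> F ^+ n = 0.
Proof.
by move=> rn; have [_ h _ _] := uz_relsP R r; rewrite -(subnKC rn) exprD h mul0r.
Qed.

Lemma uE_nilp n : (r <= n)%N -> E ^+ n = 0.
Proof.
by move=> rn; have [h _ _ _] := uz_relsP R r; rewrite -(subnKC rn) exprD h mul0r.
Qed.

Lemma Fd_nilp n : (r <= n)%N -> Fd n = 0.
Proof. by move=> rn; rewrite fdivE uF_nilp // scaler0. Qed.

Lemma Fd0 : Fd 0 = 1.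
Proof. by rewrite fdivE qfact0 invr1 scale1r. Qed.

Lemma FdivE (n : nat) : Fdiv R r n%:Z = Fd n.
Proof.
rewrite /Fdiv; case: ifP => h; first by rewrite fdivE.
by rewrite Fd_nilp //; lia.
Qed.

Lemma uF_Fd n : (n.+1 < r)%N -> F * Fd n = qi n.+1%:Z *: Fd n.+1.
Proof.
move=> nr; rewrite !fdivE -scalerAr -exprS scalerA; congr (_ *: _).
rewrite qfactS; have := @qint_neq0 n.+1 nr; have := qfact_neq0 (ltnW nr).
by move=> h1 h2; field; apply/andP.
Qed.

Lemma Fd_uF n : Fd n * F = F * Fd n.
Proof. by rewrite !fdivE -scalerAl -scalerAr -exprS -exprSr. Qed.

Lemma Fd_mul a b : (a < r)%N -> (b < r)%N ->
  Fd a * Fd b = qbin (a + b) a *: Fd (a + b).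
Proof.
move=> ar br; have [abr|rab] := ltnP (a + b) r; last first.
  rewrite [Fd (a + b)]Fd_nilp // scaler0 !fdivE -scalerAl -scalerAr -exprD.
  by rewrite uF_nilp // !scaler0.
rewrite qbinE; last by rewrite leq_addr.
have -> : (a + b - a = b)%N by lia.
rewrite !fdivE -scalerAl -scalerAr -exprD !scalerA; congr (_ *: _).
have := qfact_neq0 ar; have := qfact_neq0 br; have := qfact_neq0 abr.
by move=> h1 h2 h3; field; rewrite h1 h2 h3.
Qed.

Lemma TidemFd m n : T m * Fd n = Fd n * T (m - n%:Z).
Proof. by rewrite fdivE -scalerAr TidemFX -scalerAl. Qed.

(** Every [E] that passes [F] contributes a brace depending on the current weight, and [qint_mul]
    adds these up to a single product. The truncated power [N.-1] at [N = 0] is harmless, since its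
    coefficient contains [qi 0]. *)
Lemma Tidem_uFE m N :
  T m * (F * E ^+ N) = T m * (E ^+ N * F) +
    (qi N%:Z * brace (2 * m - 1 + N%:Z)) *: (T m * E ^+ N.-1).
Proof.
have base m' : T m' * (F * E) = T m' * (E * F) + brace (2 * m') *: T m'.
  have -> : F * E = E * F - (K - K^-1) by rewrite -uEF opprB addrC subrK.
  rewrite mulrBr mulrBr TidemK -[K^-1]/(K ^- 1) TidemKV mulr1 -scalerBl.
  by rewrite -scaleNr opprB /qbrace.
elim: N => [|N IH].
  by rewrite qint0 mul0r scale0r addr0 mul1r mulr1.
rewrite /= exprSr.
have -> : T m * (F * (E ^+ N * E)) = T m * (F * E ^+ N) * E by rewrite !mulrA.
rewrite IH mulrDl -scalerAl.
have -> : T m * (E ^+ N * F) * E = T m * (E ^+ N * E * F) +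
    brace (2 * (m + N%:Z)) *: (T m * E ^+ N).
  transitivity (E ^+ N * (T (m + N%:Z) * (F * E))).
    by rewrite !mulrA TidemEX.
  by rewrite base mulrDr -scalerAr !mulrA -TidemEX.
rewrite !mulrA -addrA; congr (_ + _).
have -> : (qi N%:Z * brace (2 * m - 1 + N%:Z)) *: (T m * E ^+ N.-1 * E) =
   (qi N%:Z * brace (2 * m - 1 + N%:Z)) *: (T m * E ^+ N).
  by case: N {IH} => [|N]; rewrite ?qint0 ?mul0r ?scale0r // -mulrA -exprSr.
rewrite -scalerDl; congr (_ *: _).
have := qint_mul (2 * m + N%:Z) 1 N.+1%:Z.
rewrite qint1 mul1r (_ : 2 * m - 1 + N.+1%:Z = 2 * m + N%:Z) => [<-|]; last by lia.
rewrite addrC.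
by congr (qi _ * brace _ + brace _); lia.
Qed.

(** Here [c] counts the cancelled pairs of [E] and [F]. In the induction on [t], multiplication by
    [qi t.+1] splits one [F] off [Fd t.+1]. Passing the remaining powers of [E], this [F] either
    survives ([X c]) or cancels one more [E] ([Y c]); the two contributions to [B c.+1] are merged
    by [qbinS] and [qint_mul]. *)
Lemma Tidem_Fd_uE m t M : (t < r)%N ->
  T m * (Fd t * E ^+ M) =
  \sum_(c < t.+1) (qbin M c * \prod_(j < c) brace (2 * m - t%:Z + M%:Z - j%:Z))
    *: (T m * (E ^+ (M - c) * Fd (t - c))).
Proof.
elim: t m => [|t IH] m tr.
  by rewrite big_ord1 qbin0 big_ord0 mulr1 scale1r subn0 Fd0 mul1r mulr1.
pose B c := T m * (E ^+ (M - c) * Fd (t.+1 - c)).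
pose a c := qbin M c * \prod_(j < c) brace (2 * (m - 1) - t%:Z + M%:Z - j%:Z).
pose X c := (a c * qi (t.+1%:Z - c%:Z)) *: B c.
pose Y c := (a c * (qi (M%:Z - c%:Z) * brace (2 * m - 1 + M%:Z - c%:Z)))
              *: B c.+1.
have qt : qi t.+1%:Z != 0 by rewrite qint_neq0.
apply: (scalerI qt).
rewrite (scalerAr _ (T m)) (scalerAl _ _ (E ^+ M)) -uF_Fd //.
have -> : T m * (F * Fd t * E ^+ M) = F * (T (m - 1) * (Fd t * E ^+ M)).
  by rewrite !mulrA TidemF.
rewrite IH ?(ltnW tr) // mulr_sumr.
rewrite (eq_bigr (fun c : 'I_t.+1 => X c + Y c)) => [|[c /= ct] _]; last first.
  have [cM|Mc] := leqP c M; last first.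
    by rewrite /X /Y /a qbin_small // !(mul0r, scale0r) mulr0 addr0.
  rewrite -scalerAr /X /Y -!(scalerA (a c)) -scalerDr; congr (_ *: _).
  have -> : F * (T (m - 1) * (E ^+ (M - c) * Fd (t - c))) =
      T m * (F * E ^+ (M - c)) * Fd (t - c).
    by rewrite !mulrA TidemF.
  rewrite Tidem_uFE mulrDl -scalerAl.
  have -> : T m * (E ^+ (M - c) * F) * Fd (t - c) =
      qi (t.+1%:Z - c%:Z) *: B c.
    rewrite /B subSn // -!mulrA uF_Fd; last by lia.
    rewrite -!scalerAr; congr (qi _ *: _); lia.
  rewrite /B subSS subnS -(mulrA (T m)); congr (_ + (qi _ * brace _) *: _); lia.
rewrite big_split /= scaler_sumr.
have XE : \sum_(c < t.+1) X c = \sum_(c < t.+2) X c.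
  by rewrite [RHS]big_ord_recr /= [X t.+1]/X subrr qint0 mulr0 scale0r addr0.
rewrite XE big_ord_recl [RHS]big_ord_recl -addrA -big_split /=; congr (_ + _).
  by rewrite /X /B /a !qbin0 !big_ord0 !mul1r subr0 !scalerA mulr1.
apply: eq_bigr => [[c /= ct] _]; rewrite /X /Y /bump /= add1n -scalerDl.
rewrite scalerA; congr (_ *: _); rewrite /a.
pose A := 2 * m - t.+1%:Z + M%:Z.
pose P := \prod_(j < c) brace (A - 1 - j%:Z).
have -> : \prod_(j < c) brace (2 * (m - 1) - t%:Z + M%:Z - j%:Z) = P.
  by apply: eq_bigr => j _; congr (brace _); rewrite /A; lia.
have -> : \prod_(j < c.+1) brace (2 * (m - 1) - t%:Z + M%:Z - j%:Z) =
    P * brace (A - c.+1%:Z).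
  rewrite big_ord_recr /=; congr (_ * brace _); last by rewrite /A; lia.
  by apply: eq_bigr => j _; congr (brace _); rewrite /A; lia.
have -> : \prod_(j < c.+1) brace (2 * m - t.+1%:Z + M%:Z - j%:Z) = brace A * P.
  rewrite big_ord_recl /=; congr (brace _ * _); first by rewrite /A; lia.
  by apply: eq_bigr => j _; congr (brace _); rewrite /A /bump /=; lia.
have -> : brace (2 * m - 1 + M%:Z - c%:Z) = brace (A + t.+1%:Z - c.+1%:Z).
  by congr (brace _); rewrite /A; lia.
have H := qint_mul A c.+1%:Z t.+1%:Z.
have Hb := @qbinS M c ltac:(lia).
transitivity (P * (qbin M c.+1 * (qi t.+1%:Z * brace A))); last by ring.
transitivity (P * (qbin M c.+1 * (qi (t.+1%:Z - c.+1%:Z) * brace (A - c.+1%:Z)))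
    + P * (qbin M c * qi (M%:Z - c%:Z) * brace (A + t.+1%:Z - c.+1%:Z))).
  by ring.
by rewrite -Hb -H; ring.
Qed.

Lemma TidemXE m n : E ^+ n * T m = T (m - n%:Z) * E ^+ n.
Proof. by rewrite TidemEX subrK. Qed.

Lemma TidemFE m n : Fd n * E ^+ n * T m = T m * (Fd n * E ^+ n).
Proof. by rewrite -mulrA TidemXE !mulrA TidemFd. Qed.

(** The case [M = 1] of [Tidem_Fd_uE], taken at weight [m + n] so that the idempotent arrives on the
    right as [T m]. *)
Lemma uE_Fd_Tidem m n : (n.+1 < r)%N ->
  E * Fd n.+1 * T m = Fd n.+1 * E * T m - brace (2 * m + n%:Z) *: (Fd n * T m).
Proof.
move=> nr; have := Tidem_Fd_uE (m + n%:Z) 1 nr.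
rewrite 2!big_ord_recl [X in _ + (_ + X)]big1 => [|c _]; last first.
  by rewrite qbin_small ?mul0r ?scale0r.
rewrite qbin0 big_ord0 mulr1 scale1r addr0 expr1 mul1r subn1 /=.
have -> : qbin 1 (bump 0 0) = 1.
  by rewrite /qbin big_ord1 qfactS qfact0 subr0 mul1r divff // qint1 oner_eq0.
rewrite big_ord1 mul1r !mulrA => H.
rewrite TidemFd -(mulrA (Fd n.+1)) TidemE mulrA in H.
rewrite TidemE -(mulrA E) TidemFd mulrA in H.
rewrite TidemFd in H.
move: H.
have -> : m + n%:Z - n.+1%:Z + 1 = m by lia.
have -> : m + n%:Z + 1 - n.+1%:Z = m by lia.
have -> : m + n%:Z - n%:Z = m by lia.
move=> ->; rewrite subn0.
rewrite (_ : brace (2 * (m + n%:Z) - _ + _ - _) = brace (2 * m + n%:Z)) ?addrK //.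
by congr (brace _); rewrite /=; lia.
Qed.

Lemma scale_qint_Fd n : (n < r)%N -> qi n.+1%:Z *: Fd n.+1 = F * Fd n.
Proof.
move=> nr; have [n1r|rn1] := ltnP n.+1 r; first by rewrite uF_Fd.
by rewrite Fd_nilp // scaler0 fdivE -scalerAr -exprS uF_nilp // scaler0.
Qed.

(** * The inverse of the ribbon element *)

Definition gauss_elt : uz :=
  \sum_(a < r) z ^ (2 * a%:Z * (a%:Z - 1)) *: T a%:Z.

Lemma gauss_elt_Tidem m :
  gauss_elt * T m = z ^ (2 * m * (m - 1)) *: T m.
Proof.
rewrite /gauss_elt mulr_suml.
rewrite (eq_bigr (fun a : 'I_r => (z ^ (2 * a%:Z * (a%:Z - 1)) *
    (r%:Z %| a%:Z - m)%Z%:R) *: T m)) => [|a _].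
  rewrite -scaler_suml.
  rewrite (@sum_period_delta (fun a => z ^ (2 * a * (a - 1)))) // => a k.
  by apply: (@zeta_period _ _ (2 * k * (2 * a - 1 + r%:Z * k))); ring.
by rewrite -scalerAl Tidem_mul scalerA.
Qed.

Definition ribbon_inv : uz :=
  \sum_(n < r) z ^ 'C(n, 2)%:Z *: (Fd n * gauss_elt * K ^- n * E ^+ n).

(** After [E ^+ n] has passed [T m] the weight is [m - n]. There the Gauss element contributes
    [2 * (m - n) * (m - n - 1)] and [K ^- n] contributes [2 * (m - n) * n]. *)
Definition ribbon_coef (n : nat) (m : int) : C :=
  z ^ ('C(n, 2)%:Z + 2 * (m - n%:Z) * (m - 1)).

Lemma ribbon_inv_Tidem m :
  ribbon_inv * T m = \sum_(n < r) ribbon_coef n m *: (Fd n * E ^+ n * T m).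
Proof.
rewrite /ribbon_inv mulr_suml; apply: eq_bigr => n _.
rewrite -scalerAl -!(mulrA (Fd n)) -!(mulrA gauss_elt) -(mulrA (K ^- n)) TidemXE.
rewrite (mulrA (K ^- n)) uKVTidem -scalerAl -scalerAr (mulrA gauss_elt).
rewrite gauss_elt_Tidem -scalerAl scalerA -scalerAr scalerA /ribbon_coef.
by rewrite -!zetaD; congr (z ^ _ *: _); lia.
Qed.

Lemma ribbon_inv_uK : ribbon_inv * K = K * ribbon_inv.
Proof.
apply: eq_mulTidem => m; rewrite -!mulrA uKTidem -scalerAr ribbon_inv_Tidem.
rewrite mulr_sumr scaler_sumr; apply: eq_bigr => n _.
rewrite TidemFE -(scalerAr (ribbon_coef n m)) (mulrA K) uKTidem -scalerAl.
by rewrite !scalerA mulrC.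
Qed.

Lemma ribbon_inv_uE : ribbon_inv * E = E * ribbon_inv.
Proof.
apply: eq_mulTidem => m; rewrite -!mulrA ribbon_inv_Tidem.
have -> : E * T m = T (m - 1) * E by rewrite TidemE subrK.
rewrite mulrA ribbon_inv_Tidem mulr_suml mulr_sumr.
(* [b n] is the lower term left when [E] passes [Fd n]. It is 0 at [n = 0] by the default and at
   [n = r] by nilpotency of [E], so it may be shifted by one; [b n.+1] is then a multiple of [Q n],
   and only coefficients remain to be compared. *)
pose b n := - (ribbon_coef n m * brace (2 * m - n%:Z - 1)) *:
  ((if n is k.+1 then Fd k else 0) * E ^+ n * T m).
have br : b r = b 0%N by rewrite /b uE_nilp // mulr0 !mul0r !scaler0.
pose Q n := Fd n * E ^+ n.+1 * T m.
transitivity (\sum_(n < r) (ribbon_coef n m *: Q n + b n)).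
  rewrite big_split /= -(sum_ordS br) -big_split; apply: eq_bigr => n _ /=.
  rewrite -scalerAl.
  have -> : Fd n * E ^+ n * T (m - 1) * E = Q n.
    by rewrite /Q -mulrA TidemE subrK !mulrA exprSr mulrA.
  rewrite /b -/(Q n) -scalerDl; congr (_ *: _).
  rewrite /ribbon_coef /qbrace (mulrBr (z ^ _)) -!zetaD.
  have -> : 'C(n.+1, 2)%:Z = 'C(n, 2)%:Z + n%:Z by rewrite binS bin1; lia.
  rewrite (_ : 'C(n, 2)%:Z + n%:Z + _ + (2 * m - _ - 1) =
    'C(n, 2)%:Z + 2 * (m - n%:Z) * (m - 1)); last by lia.
  rewrite (opprB (z ^ _)) (addrCA (z ^ _)) (subrr (z ^ _)) addr0.
  by congr (z ^ _); lia.
apply: eq_bigr => [[[|k] kr] _] /=.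
  by rewrite /b !mul0r scaler0 addr0 /Q Fd0 !mul1r -scalerAr.
rewrite -scalerAr /b scaleNr -scalerA -scalerBr; congr (_ *: _).
have X1 (x : uz) : x * E ^+ k.+1 * T m = x * T (m - k.+1%:Z) * E ^+ k.+1.
  by rewrite -mulrA TidemXE mulrA.
rewrite /Q [E ^+ k.+2]exprS (mulrA (Fd k.+1)) !X1 (mulrA E) (mulrA E).
rewrite uE_Fd_Tidem // mulrBl -scalerAl.
by congr (_ - brace _ *: _); lia.
Qed.

Lemma ribbon_inv_uF : ribbon_inv * F = F * ribbon_inv.
Proof.
apply: eq_mulTidem => m; rewrite -!mulrA ribbon_inv_Tidem.
have -> : F * T m = T (m + 1) * F by rewrite TidemF addrK.
rewrite mulrA ribbon_inv_Tidem mulr_suml mulr_sumr.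
(* The mirror image of the argument for [E]: [b n] is the term left when [F] passes [E ^+ n], and it
   vanishes at 0 because of [qi 0] and at [r] because of [Fd r]. *)
pose b n := - (ribbon_coef n (m + 1) * brace (2 * m + 1 - n%:Z)) *:
  (qi n%:Z *: (Fd n * E ^+ n.-1 * T m)).
have br : b r = b 0%N.
  by rewrite /b Fd_nilp // qint0 scale0r !mul0r !scaler0.
pose Q n := F * Fd n * E ^+ n * T m.
transitivity (\sum_(n < r) (ribbon_coef n (m + 1) *: Q n + b n)).
  apply: eq_bigr => [[n nr] _] /=; rewrite -scalerAl /b scaleNr -scalerA.
  rewrite -scalerBr; congr (_ *: _).
  rewrite -!mulrA [E ^+ n * _]mulrA TidemXE -!mulrA.
  have := Tidem_uFE (m + 1 - n%:Z) n => /esym/(canRL (addrK _)) ->.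
  rewrite mulrBr /Q -Fd_uF; congr (_ - _).
    by rewrite (mulrA (T _)) TidemF -(mulrA F) TidemEX !mulrA; congr (_ * T _); lia.
  rewrite scalerA [brace _ * _]mulrC -scalerAr.
  have -> : 2 * (m + 1 - n%:Z) - 1 + n%:Z = 2 * m + 1 - n%:Z by lia.
  case: n nr => [|n] nr; first by rewrite qint0 !mul0r !scale0r.
  by rewrite TidemXE /=; congr (_ *: (_ * (T _ * _))); lia.
rewrite big_split /= -(sum_ordS br) -big_split; apply: eq_bigr => [[n nr] _] /=.
rewrite -scalerAr !mulrA -/(Q n) /b 2!(scalerAl (qi _)) scale_qint_Fd //=.
rewrite -/(Q n) -scalerDl; congr (_ *: _).
rewrite /ribbon_coef /qbrace (mulrBr (z ^ _)) -!zetaD.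
have -> : 'C(n.+1, 2)%:Z = 'C(n, 2)%:Z + n%:Z by rewrite binS bin1; lia.
rewrite (_ : 'C(n, 2)%:Z + n%:Z + _ + (2 * m + 1 - _) =
  'C(n, 2)%:Z + 2 * (m + 1 - n%:Z) * (m + 1 - 1)); last by lia.
rewrite (opprB (z ^ _)) (addrCA (z ^ _)) (subrr (z ^ _)) addr0.
by congr (z ^ _); lia.
Qed.

(** * The antipode, the Drinfeld element and the inverse of the ribbon element *)

Lemma antipodeX x n : S (x ^+ n) = S x ^+ n.
Proof.
elim: n => [|n IH]; first by rewrite uz_antipode1.
by rewrite exprS uz_antipodeM IH exprSr.
Qed.

HB.instance Definition _ := GRing.isLinear.Build C uz uz *:%R S
  (@uz_antipode_linear R r).

Lemma Tidem_antipode_uFX m n :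
  T m * S (F ^+ n) =
    ((-1) ^+ n * z ^ (n%:Z * (n%:Z - 1) - 2 * m * n%:Z)) *: (T m * F ^+ n).
Proof.
elim: n m => [|n IH] m.
  rewrite (@zeta_period _ 0 0); last by lia.
  by rewrite uz_antipode1 !mulr1 scale1r.
rewrite exprSr uz_antipodeM uz_antipodeF.
have -> : T m * (- K * F * S (F ^+ n)) = - (T m * K * F * S (F ^+ n)).
  by rewrite !mulNr mulrN !mulrA.
rewrite TidemK -!scalerAl TidemF -(mulrA F) IH -scalerAr scalerA -scaleNr (mulrA F).
rewrite -TidemF -(mulrA (T m)) -exprS -exprSr mulrCA -zetaD.
rewrite [(-1) ^+ n.+1]exprS mulN1r mulNr.
by congr (- (_ * z ^ _) *: _); lia.
Qed.

Lemma antipode_Fd_Tidem m n :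
  S (Fd n) * T m =
    ((-1) ^+ n * z ^ (- (n%:Z * (n%:Z + 1)) - 2 * m * n%:Z)) *: (Fd n * T m).
Proof.
have TS k : S (F ^+ n) * T k = T (k + n%:Z) * S (F ^+ n).
  rewrite antipodeX uz_antipodeF; elim: n k => [|i IH] k.
    by rewrite mul1r mulr1 addr0.
  rewrite exprS -mulrA IH [LHS]mulrA.
  have -> : - K * F * T (k + i%:Z) = T (k + i.+1%:Z) * (- K * F).
    rewrite !mulNr mulrN !mulrA Tidem_comm_uK -!mulrA TidemF.
    by congr (- (_ * (_ * T _))); lia.
  by rewrite -mulrA.
rewrite fdivE linearZ /= -!scalerAl TS Tidem_antipode_uFX TidemFX addrK.
by rewrite !scalerA mulrC; congr ((_ * z ^ _ * _) *: _); lia.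
Qed.

Lemma antipode_idem_Tidem a m : S (T a) * T m = (r%:Z %| a + m)%Z%:R *: T m.
Proof.
rewrite [T a]idemE /Tidem linearZ linear_sum /= -scalerAl mulr_suml.
rewrite (eq_bigr (fun b : 'I_r => z ^ (2 * (a + m) * b%:Z) *: T m)) => [|b _].
  by rewrite -scaler_suml scalerA sum_zeta.
rewrite linearZ /= antipodeX uz_antipodeK -scalerAl exprVn uKVTidem scalerA.
by rewrite -zetaD; congr (z ^ _ *: _); lia.
Qed.

(** The Cartan part of the Drinfeld element. Multiplied by the [K^-1] of [ribbon] it acts on [T m]
    by [z ^ (- (2 * m * (m - 1)))], inverse to [gauss_elt]. *)
Definition gauss_inv : uz := \sum_(b < r) S (T b%:Z) * K ^- b.

Lemma gauss_inv_Tidem m : gauss_inv * T m = z ^ (- (2 * m * m)) *: T m.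
Proof.
rewrite mulr_suml (eq_bigr (fun b : 'I_r => (z ^ (2 * m * b%:Z) *
    (r%:Z %| b%:Z - - m)%Z%:R) *: T m)) => [|b _].
  rewrite -scaler_suml (@sum_period_delta (fun b => z ^ (2 * m * b))).
    by congr (z ^ _ *: _); lia.
  by move=> a k; apply: (@zeta_period _ _ (2 * m * k)); ring.
by rewrite -mulrA uKVTidem -scalerAr antipode_idem_Tidem scalerA opprK.
Qed.

Lemma antipode_mul_bimap : bimap (fun x y : uz => S y * x).
Proof.
split=> [y|x] a u v; first by rewrite mulrDr scalerAr.
by rewrite uz_antipode_linear mulrDl scalerAl.
Qed.

Lemma bin2_half a : ((a * a.-1) %/ 2 = 'C(a, 2))%N.
Proof. by rewrite bin2 divn2. Qed.

Lemma drinfeld_eltE : drinfeld_elt R r =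
  \sum_(a < r) z ^ 'C(a, 2)%:Z *: (S (Fd a) * gauss_inv * E ^+ a).
Proof.
have lin := tens_lift_linear antipode_mul_bimap.
pose L : {linear tens uz uz -> uz} :=
  HB.pack (tens_lift (fun x y : uz => S y * x))
    (GRing.isLinear.Build C _ _ *:%R _ lin).
rewrite -[LHS]/(L (Rmatrix R r)) /Rmatrix linear_sum; apply: eq_bigr => a _.
rewrite linear_sum /gauss_inv mulr_sumr mulr_suml scaler_sumr.
apply: eq_bigr => b _; rewrite linearZ bin2_half exprnP; congr (_ *: _).
rewrite /L /= (tens_lift_pure _ _ antipode_mul_bimap) -idemE FdivE.
by rewrite uz_antipodeM /Epow /= !mulrA.
Qed.

Lemma ribbonM_ribbon_inv : ribbon R r * ribbon_inv = 1.
Proof.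
have KVw : K^-1 * ribbon_inv = ribbon_inv * K^-1.
  apply: (mulrI (uK_unit R r)); rewrite mulVKr ?uK_unit // mulrA -ribbon_inv_uK.
  by rewrite mulrK ?uK_unit.
have wEX n : ribbon_inv * E ^+ n = E ^+ n * ribbon_inv.
  elim: n => [|n IH]; first by rewrite mulr1 mul1r.
  by rewrite exprSr mulrA IH -mulrA ribbon_inv_uE mulrA.
apply: eq_mulTidem => m; rewrite mul1r /ribbon -!mulrA (mulrA K^-1) KVw.
rewrite -(mulrA ribbon_inv) -[K^-1]/(K ^- 1) uKVTidem mulr1 -!scalerAr.
(* The coefficient in [t b a] is arranged as a sign and a power [g] that depend only on [N = a + b],
   times the summand of [qfact_alternating]. *)
pose g N := 'C(N, 2)%:Z + N%:Z * N%:Z + N%:Z - 2 * m * N%:Z.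
pose t b a := ((-1) ^+ (b + a) * z ^ (g (b + a)%N) *
  ((-1) ^+ b * z ^ (- ((b + a)%N%:Z - 1) * b%:Z) / (qf b * qf a))) *:
  (F ^+ (b + a) * E ^+ (b + a) * T m).
have term (a b : 'I_r) : z ^ (2 * m) *: (z ^ 'C(a, 2)%:Z *: (S (Fd a) *
    gauss_inv * (ribbon_coef b (m - a%:Z) *: (Fd b * E ^+ b * T (m - a%:Z)) *
    E ^+ a))) = t b a.
  rewrite TidemFE -scalerAl -scalerAr !scalerA; set c1 := _ * _ * _.
  rewrite -(mulrA (T _)) -(mulrA (S _)) (mulrA gauss_inv) gauss_inv_Tidem.
  rewrite -scalerAl -scalerAr (mulrA (S _)) antipode_Fd_Tidem -scalerAl !scalerA.
  set c2 := c1 * _ * _.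
  rewrite -(mulrA (Fd a)) -(mulrA (Fd b)) -exprD (mulrA (T _)) TidemFd.
  rewrite -(mulrA (Fd b)) TidemEX (mulrA (Fd b)) (mulrA (Fd a)) (mulrA (Fd a)).
  have -> : m - a%:Z - b%:Z + (b + a)%N%:Z = m by lia.
  have -> : Fd a * Fd b = (qf b * qf a)^-1 *: F ^+ (b + a).
    rewrite !fdivE -scalerAl -scalerAr scalerA -exprD addnC -invfM.
    by rewrite [qf a * _]mulrC.
  rewrite -2!scalerAl scalerA /t; congr (_ *: _); rewrite /ribbon_coef mulrA.
  congr (_ / _).
  have -> : (-1) ^+ (b + a) * z ^ g (b + a)%N *
     ((-1) ^+ b * z ^ (- ((b + a)%N%:Z - 1) * b%:Z)) =
     (-1) ^+ a * z ^ (g (b + a)%N - ((b + a)%N%:Z - 1) * b%:Z).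
    have <- : (-1) ^+ (b + a) * (-1) ^+ b = (-1) ^+ a :> C.
      by rewrite exprD mulrAC -expr2 sqrr_sign mul1r.
    by rewrite zetaD -mulNr; ring.
  rewrite /c2 /c1 /ribbon_coef mulrCA -!zetaD; congr (_ * z ^ _).
  by rewrite /g; have := bin2_double (b + a); have := bin2_double a;
    have := bin2_double b; lia.
rewrite drinfeld_eltE mulr_suml scaler_sumr.
transitivity (\sum_(a < r) \sum_(b < r) t b a).
  apply: eq_bigr => a _; rewrite -scalerAl -(mulrA (S _ * _)).
  rewrite (mulrA (E ^+ a)) -wEX -(mulrA ribbon_inv) TidemXE (mulrA ribbon_inv).
  rewrite ribbon_inv_Tidem mulr_suml mulr_sumr !scaler_sumr.
  by apply: eq_bigr => b _; exact: term.
rewrite exchange_big /=.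
(* Terms with [a + b >= r] contain a vanishing power of [E]; the remaining triangle is regrouped by
   [a + b]. *)
transitivity (\sum_(b < r) \sum_(a < r - b) t b a).
  apply: eq_bigr => b _; apply: sum_ord_trunc => [|a ar]; first exact: leq_subr.
  by rewrite /t uE_nilp ?mulr0 ?mul0r ?scaler0 //; lia.
rewrite -sum_triangle (bigD1 (Ordinal (level_gt0 r))) //= [X in _ + X]big1 ?addr0.
  rewrite big_ord1 -[t _ _]/(t 0%N 0%N) /t !qfact0 mulr1 invr1.
  rewrite (@zeta_period _ 0 0); last by rewrite /g bin0n; lia.
  by rewrite !mulr1 scale1r mul1r.
case=> n nr; rewrite -val_eqE /= => n0.
pose s := (-1) ^+ n * z ^ (g n).
transitivity (\sum_(k < n.+1) (s * ((-1) ^+ k * z ^ (- (n%:Z - 1) * k%:Z) /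
  (qf k * qf (n - k)))) *: (F ^+ n * E ^+ n * T m)).
  by apply: eq_bigr => k _; rewrite /t subnKC // -ltnS.
by rewrite -scaler_suml -mulr_sumr qfact_alternating ?mulr0 ?scale0r // lt0n n0.
Qed.

Lemma ribbon_inv_central x : ribbon_inv * x = x * ribbon_inv.
Proof.
elim/uz_ind: x => [||||x y IHx IHy|x y IHx IHy].
- exact: ribbon_inv_uE.
- exact: ribbon_inv_uF.
- exact: ribbon_inv_uK.
- by move=> c; rewrite mulr_algl mulr_algr.
- by rewrite mulrDl mulrDr IHx IHy.
- by rewrite mulrA IHx -mulrA IHy mulrA.
Qed.

Lemma ribbonV : (ribbon R r)^-1 = ribbon_inv.
Proof.
have h : ribbon_inv * ribbon R r = 1.
  by rewrite ribbon_inv_central ribbonM_ribbon_inv.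
have u : ribbon R r \is a GRing.unit.
  by apply/unitrP; exists ribbon_inv; rewrite h ribbonM_ribbon_inv.
by apply: (mulrI u); rewrite divrr // ribbonM_ribbon_inv.
Qed.
(** * Action of the coproduct of the inverse ribbon element *)

Lemma qmultinom_lt0 (k c : int) : c < 0 -> qmultinom R r k [:: c] = 0.
Proof. by move=> c0; rewrite /qmultinom /= [0 <= c]leNgt c0 andbF. Qed.

Lemma Fd_comm a b : Fd a * Fd b = Fd b * Fd a.
Proof. by rewrite !fdivE -!scalerAl -!scalerAr -!exprD addnC !scalerA mulrC. Qed.

(** [Tidem_Fd_uE] sums over the number [c] of cancelled pairs; the statement uses the number
    [j = p - c] of surviving [E], as in the target formula. *)
Lemma left_factor l m n p s : (n < r)%N -> (s < r)%N -> (p < r)%N ->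
  E ^+ l * T m * Fd n * E ^+ p * Fd s =
  \sum_(j < p.+1)
    (qbin p (p - j) * qfall R r (2 * m - n%:Z + p%:Z) (p - j)%N%:Z *
     qmultinom R r (n%:Z + s%:Z - (p - j)%N%:Z) [:: n%:Z - (p - j)%N%:Z]) *:
    (E ^+ (l + j) * T (m + j%:Z) * Fdiv R r (n%:Z + s%:Z - (p - j)%N%:Z)).
Proof.
move=> nr sr pr.
pose f c := (qbin p c * qfall R r (2 * m - n%:Z + p%:Z) c%:Z *
     qmultinom R r (n%:Z + s%:Z - c%:Z) [:: n%:Z - c%:Z]) *:
    (E ^+ (l + (p - c)) * T (m + (p - c)%N%:Z) * Fdiv R r (n%:Z + s%:Z - c%:Z)).
transitivity (\sum_(c < n.+1) f c).
  rewrite -2!(mulrA (E ^+ l)) -(mulrA (T m)) Tidem_Fd_uE // mulr_sumr mulr_suml.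
  apply: eq_bigr => [[c /= cn] _]; rewrite -scalerAr -scalerAl /f.
  have [cp|pc] := leqP c p; last by rewrite qbin_small // !mul0r !scale0r.
  rewrite -qfall_nat (mulrA (T m)) TidemEX !mulrA -exprD -(mulrA _ (Fd _)).
  rewrite Fd_mul; try by lia.
  have -> : n%:Z - c%:Z = (n - c)%N%:Z by lia.
  have -> : n%:Z + s%:Z - c%:Z = (n - c + s)%N%:Z by lia.
  rewrite qmultinom1; last by lia.
  by rewrite FdivE -scalerAr scalerA.
(* The ranges [c <= n] and [c <= p] give the same sum: beyond [n] the multinomial has a negative
   entry, beyond [p] the binomial vanishes. *)
have f0 c : (n < c)%N || (p < c)%N -> f c = 0.
  rewrite /f => /orP[nc|pc]; last by rewrite qbin_small ?mul0r ?scale0r.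
  by rewrite qmultinom_lt0 ?mulr0 ?scale0r //; lia.
rewrite -(@sum_ord_trunc _ f (maxn n p).+1); first last.
- by move=> j jn; apply: f0; lia.
- by lia.
rewrite (@sum_ord_trunc _ f (maxn n p).+1 p.+1); first last.
- by move=> j jn; apply: f0; lia.
- by lia.
rewrite sum_ord_rev; apply: eq_bigr => [[j jp] _] /=.
by rewrite /f subKn.
Qed.

(** All of [E ^+ (l + k)] is moved past [Fd t] at once; [i] is the number of [F] from [Fd t] that
    survive. *)
Lemma right_factor l m n t k : (n < r)%N -> (t < r)%N ->
  Fd t * E ^+ k * (E ^+ l * T m * Fd n) =
  \sum_(i < t.+1)
    (qbin (l + k) (t - i) * qfall R r (2 * m - l%:Z + t%:Z - k%:Z) (t - i)%N%:Z *
     qbin (n + i) n) *: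
    (Epow R r (l%:Z + k%:Z - t%:Z + i%:Z) * T (m + i%:Z) * Fd (n + i)).
Proof.
move=> nr tr.
have -> : Fd t * E ^+ k * (E ^+ l * T m * Fd n) =
    T (m - (l + k)%N%:Z + t%:Z) * (Fd t * E ^+ (l + k)) * Fd n.
  have -> : T (m - (l + k)%N%:Z + t%:Z) * (Fd t * E ^+ (l + k)) =
      Fd t * E ^+ (l + k) * T m.
    by rewrite mulrA TidemFd -mulrA TidemEX mulrA; congr (_ * T _); lia.
  by rewrite addnC exprD !mulrA.
pose m' := m - (l + k)%N%:Z + t%:Z.
pose f c := (qbin (l + k) c *
    \prod_(j < c) brace (2 * m' - t%:Z + (l + k)%N%:Z - j%:Z)) *:
  (T m' * (E ^+ (l + k - c) * Fd (t - c))) * Fd n.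
rewrite Tidem_Fd_uE // mulr_suml -/m' -[LHS]/(\sum_(c < t.+1) f c) sum_ord_rev.
apply: eq_bigr => [[i /= it] _].
rewrite /f /m' -scalerAl -qfall_nat subKn //.
have [tl|lt] := leqP (t - i) (l + k); last by rewrite qbin_small // !mul0r !scale0r.
have -> : Epow R r (l%:Z + k%:Z - t%:Z + i%:Z) = E ^+ (l + k - (t - i)).
  by rewrite /Epow ifT; last lia; congr (_ ^+ _); lia.
rewrite (mulrA (T _)) TidemEX -(mulrA _ (Fd i)) Fd_comm Fd_mul //; last by lia.
rewrite -scalerAr scalerA.
have -> : m - (l + k)%N%:Z + t%:Z + (l + k - (t - i))%N%:Z = m + i%:Z by lia.
congr ((_ * qfall _ _ _ _ * _) *: _); lia.
Qed.

(** * Applying the coproduct factor by factor *)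

Lemma tpZl c (x y : uz) : (c *: x) ⊗ y = c *: (x ⊗ y).
Proof.
by have := scalable_linear ((tpure_bilinear uz uz).1 y) c x.
Qed.

Lemma tpZr c (x y : uz) : x ⊗ (c *: y) = c *: (x ⊗ y).
Proof.
by have := scalable_linear ((tpure_bilinear uz uz).2 x) c y.
Qed.

(** The inner map of [rho2_twist] with the coproduct replaced by a free tensor, so that a product of
    coproducts can be consumed one factor at a time. *)
Definition twist_by (x y : uz) : U2 -> U2 :=
  tens_lift (fun a b => (x * S a) ⊗ (b * y)).

Lemma twist_by_bimap x y : bimap (fun a b => (x * S a) ⊗ (b * y) : U2).
Proof.
split=> [b|a] c u v.
- rewrite uz_antipode_linear mulrDr -scalerAr.
  exact: (tpure_bilinear uz uz).1.
- rewrite mulrDl -scalerAl.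
  exact: (tpure_bilinear uz uz).2.
Qed.

HB.instance Definition _ x y := GRing.isLinear.Build C U2 U2 *:%R (twist_by x y)
  (tens_lift_linear (twist_by_bimap x y)).

Lemma twist_by_pure x y a b : twist_by x y (a ⊗ b) = (x * S a) ⊗ (b * y).
Proof. exact: tens_lift_pure _ _ (twist_by_bimap x y). Qed.

(** Because [S] reverses products, the rightmost factor acts first and is absorbed into [x] and [y].
    This dictates the order in [rho2_twist_expansion]: powers of [E], then the Cartan part, then
    [Fd n]. *)
Lemma twist_byM x y t a b :
  twist_by x y (t * (a ⊗ b)) = twist_by (x * S a) (b * y) t.
Proof.
elim/tens_ind: t => [a' b'|t u IHt IHu].
  by rewrite tens_pureM !twist_by_pure uz_antipodeM !mulrA.
by rewrite mulrDl !linearD /= IHt IHu.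
Qed.

Lemma twist_byZl c x y t : twist_by (c *: x) y t = c *: twist_by x y t.
Proof.
elim/tens_ind: t => [a b|t u IHt IHu].
  by rewrite !twist_by_pure -scalerAl tpZl.
by rewrite !linearD /= IHt IHu.
Qed.

Lemma twist_byZr c x y t : twist_by x (c *: y) t = c *: twist_by x y t.
Proof.
elim/tens_ind: t => [a b|t u IHt IHu].
  by rewrite !twist_by_pure -scalerAr tpZr.
by rewrite !linearD /= IHt IHu.
Qed.

HB.instance Definition _ := GRing.isLinear.Build C uz U2 *:%R (@uz_comul R r)
  (@uz_comul_linear R r).

Lemma uz_comulX (x : uz) n : uz_comul (x ^+ n) = uz_comul x ^+ n.
Proof.
elim: n => [|n IH]; first by rewrite uz_comul1.
by rewrite !exprS uz_comulM IH.
Qed.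

Lemma uz_comul_uEX n : (n < r)%N -> uz_comul (E ^+ n) =
  \sum_(p < n.+1) (z ^ (p%:Z * (n - p)%N%:Z) * qbin n (n - p)) *:
    ((E ^+ p) ⊗ (E ^+ (n - p) * K ^+ p)).
Proof.
move=> nr; rewrite uz_comulX uz_comulE addrC.
rewrite (@qbinomial _ (z ^+ 2) U2); last first.
  by rewrite !tens_pureM mul1r mulr1 uKE tpZr.
pose f k := gauss_binom (z ^+ 2) n k *:
  ((1 ⊗ E : U2) ^+ k * (E ⊗ K) ^+ (n - k)).
rewrite -[LHS]/(\sum_(k < n.+1) f k) sum_ord_rev.
apply: eq_bigr => [[p /= pn] _]; rewrite /f subKn //.
rewrite gauss_binom_qbin; last by lia.
rewrite !tens_pureX tens_pureM expr1n mul1r; congr ((z ^ _ * _) *: _); lia.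
Qed.

(** The factorial in [Fd n] absorbs the q-binomial coefficient, so divided powers leave only a power
    of zeta. *)
Lemma uz_comul_Fd n : (n < r)%N -> uz_comul (Fd n) =
  \sum_(t < n.+1) z ^ (t%:Z * (n - t)%N%:Z) *:
    ((Fd (n - t) * K ^- t) ⊗ Fd t).
Proof.
move=> nr; rewrite fdivE linearZ /= uz_comulX uz_comulF addrC.
rewrite (@qbinomial _ (z ^+ 2) U2); last first.
  by rewrite !tens_pureM mul1r mulr1 uKVF tpZl.
pose f k := gauss_binom (z ^+ 2) n k *:
  ((F ⊗ 1 : U2) ^+ k * (K^-1 ⊗ F) ^+ (n - k)).
rewrite -[X in _ *: X]/(\sum_(k < n.+1) f k) sum_ord_rev scaler_sumr.
apply: eq_bigr => [[t /= tn] _]; rewrite /f subKn //.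
rewrite gauss_binom_qbin; last by lia.
rewrite !tens_pureX tens_pureM expr1n mul1r exprVn !fdivE -scalerAl tpZl tpZr.
rewrite !scalerA; congr (_ *: _).
rewrite qbinE ?subKn //; last by lia.
have h1 : qf n != 0 by exact: qfact_neq0.
have h2 : qf t != 0 by apply: qfact_neq0; lia.
have h3 : qf (n - t) != 0 by apply: qfact_neq0; lia.
have -> : (n - t)%N%:Z * (n%:Z - (n - t)%N%:Z) = t%:Z * (n - t)%N%:Z by lia.
by field; rewrite h1 h2 h3.
Qed.

Lemma uz_comul_idem a : uz_comul (T a) =
  r%:R^-1 *: \sum_(b < r) z ^ (2 * a * b%:Z) *: (K ⊗ K) ^+ b.
Proof.
rewrite idemE /Tidem linearZ linear_sum /=; congr (_ *: _).
by apply: eq_bigr => b _; rewrite linearZ /= uz_comulX uz_comulK.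
Qed.

(** [K ⊗ K] acts through [x * K^-1] and [K * y], hence by the scalar [z ^ (2 * (m - n))]: the twist
    sees only the weight difference [n - m], and the coproduct of [T a] projects onto it. *)
Lemma twist_by_comul_idem x y t a m n : x = x * T m -> y = T n * y ->
  twist_by x y (t * uz_comul (T a)) =
    (r%:Z %| a - (n - m))%Z%:R *: twist_by x y t.
Proof.
move=> xm yn; rewrite uz_comul_idem -scalerAr linearZ /= mulr_sumr.
rewrite (linear_sum (twist_by x y)) /=.
rewrite (eq_bigr (fun b : 'I_r => z ^ (2 * (a - (n - m)) * b%:Z) *:
  twist_by x y t)) => [|b _].
  by rewrite -scaler_suml scalerA sum_zeta.
rewrite -scalerAr linearZ /= tens_pureX twist_byM.
rewrite antipodeX uz_antipodeK exprVn xm yn -(mulrA x) TidemKV (mulrA _ (T n)).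
rewrite uKXTidem -scalerAr -scalerAl twist_byZl twist_byZr !scalerA -!zetaD.
by congr (z ^ _ *: _); lia.
Qed.

Lemma twist_by_gauss x y t m n k : x = x * T m -> y = T n * y ->
  twist_by x y (t * uz_comul (gauss_elt * K ^- k)) =
    z ^ (2 * (n - m) * (n - m - 1) + 2 * (n - m) * k%:Z) *: twist_by x y t.
Proof.
move=> xm yn.
pose h a := z ^ (2 * a * (a - 1) + 2 * a * k%:Z).
have -> : gauss_elt * K ^- k = \sum_(a < r) h a%:Z *: T a%:Z.
  rewrite mulr_suml; apply: eq_bigr => a _.
  by rewrite -scalerAl TidemKV scalerA -zetaD.
rewrite (linear_sum (@uz_comul R r)) mulr_sumr (linear_sum (twist_by x y)) /=.
rewrite (eq_bigr (fun a : 'I_r => (h a%:Z * (r%:Z %| a%:Z - (n - m))%Z%:R) *: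
  twist_by x y t)) => [|a _].
  rewrite -scaler_suml sum_period_delta // => a b.
  apply: (@zeta_period _ _ (2 * b * (2 * a - 1 + r%:Z * b) + 2 * b * k%:Z)).
  by ring.
by rewrite linearZ /= -scalerAr linearZ /= (twist_by_comul_idem _ _ xm yn) scalerA.
Qed.

Lemma Tidem_antipode_uEX m p :
  T m * S (E ^+ p) =
    ((-1) ^+ p * z ^ (p%:Z * (p%:Z + 1) + 2 * m * p%:Z)) *: (T m * E ^+ p).
Proof.
elim: p m => [|p IH] m.
  rewrite (@zeta_period _ 0 0); last by lia.
  by rewrite uz_antipode1 !mulr1 scale1r.
rewrite exprSr uz_antipodeM uz_antipodeE.
have -> : T m * (- E * K^-1 * S (E ^+ p)) =
    - (E * (T (m + 1) * K ^- 1) * S (E ^+ p)).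
  by rewrite !mulNr mulrN !mulrA TidemE.
rewrite TidemKV -scalerAr -scalerAl -(mulrA E) IH -scalerAr scalerA -scaleNr.
rewrite (mulrA E) -TidemE -(mulrA (T m)) -exprS -exprSr mulrCA -zetaD.
rewrite [(-1) ^+ p.+1]exprS mulN1r mulNr.
by congr (- (_ * z ^ _) *: _); lia.
Qed.

Lemma Tidem_antipode_Fd m n :
  T m * S (Fd n) =
    ((-1) ^+ n * z ^ (n%:Z * (n%:Z - 1) - 2 * m * n%:Z)) *: (T m * Fd n).
Proof.
rewrite fdivE linearZ /= -!scalerAr Tidem_antipode_uFX !scalerA.
by rewrite [_^-1 * _]mulrC.
Qed.

Lemma antipode_uKV n : S (K ^- n) = K ^+ n.
Proof.
rewrite -exprVn antipodeX -uK_inv antipodeX uz_antipodeK exprVn uK_inv invrK //.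
Qed.

(** The summands in order: the coefficient in [ribbon_inv]; the q-binomial in the coproduct of
    [E ^+ n]; [S (E ^+ p)] at weight [m]; [K ^+ p] acting on [y]; the Gauss element and [K ^- n] at
    weight difference [n' - m - n]; [K ^+ t] at weight [m + p]; the coproduct of [Fd n];
    [S (Fd (n - t))] at weight [m + p]. *)
Definition twist_exp (m n' : int) (n p t : nat) : int :=
  'C(n, 2)%:Z + p%:Z * (n - p)%N%:Z + (p%:Z * (p%:Z + 1) + 2 * m * p%:Z)
  - 2 * n' * p%:Z
  + (2 * (n' - m - n%:Z) * (n' - m - n%:Z - 1) + 2 * (n' - m - n%:Z) * n%:Z)
  - 2 * (m + p%:Z) * t%:Z + t%:Z * (n - t)%N%:Z
  + ((n - t)%N%:Z * ((n - t)%N%:Z - 1) - 2 * (m + p%:Z) * (n - t)%N%:Z).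

Lemma rho2_twist_expansion x y m n' : x = x * T m -> y = T n' * y ->
  rho2_twist (x ⊗ y) =
  \sum_(n < r) \sum_(p < n.+1) \sum_(t < n.+1)
    ((-1) ^+ (p + (n - t)) * qbin n (n - p) * z ^ twist_exp m n' n p t) *:
    ((x * E ^+ p * Fd (n - t)) ⊗ (Fd t * E ^+ (n - p) * y)).
Proof.
move=> xm yn; rewrite rho2_twist_pure ribbonV -/(twist_by x y _) /ribbon_inv.
rewrite (linear_sum (@uz_comul R r)) (linear_sum (twist_by x y)) /=.
apply: eq_bigr => [[n /= nr] _].
rewrite linearZ linearZ /= -(mulrA (Fd n)) uz_comulM (uz_comulM (Fd n)).
rewrite uz_comul_uEX // mulr_sumr.
rewrite (linear_sum (twist_by x y)) scaler_sumr /=.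
apply: eq_bigr => [[p /= pn] _].
rewrite -scalerAr linearZ /= twist_byM.
have -> : x * S (E ^+ p) =
    ((-1) ^+ p * z ^ (p%:Z * (p%:Z + 1) + 2 * m * p%:Z)) *: (x * E ^+ p).
  by rewrite xm -(mulrA x) Tidem_antipode_uEX -scalerAr !mulrA.
have -> : E ^+ (n - p) * K ^+ p * y = z ^ (- (2 * n' * p%:Z)) *: (E ^+ (n - p) * y).
  by rewrite yn -(mulrA (E ^+ _)) (mulrA (K ^+ p)) uKXTidem -scalerAl -scalerAr.
have xm' : x * E ^+ p = x * E ^+ p * T (m + p%:Z).
  by rewrite -(mulrA x) -TidemEX mulrA -xm.
have yn' : E ^+ (n - p) * y = T (n' - (n - p)%N%:Z) * (E ^+ (n - p) * y).
  by rewrite mulrA -TidemXE -mulrA -yn.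
rewrite twist_byZl twist_byZr (twist_by_gauss _ _ xm' yn') uz_comul_Fd //.
rewrite (linear_sum (twist_by _ _)) !scaler_sumr /=.
apply: eq_bigr => [[t /= tn] _].
rewrite [twist_by _ _ (_ *: _)]linearZ /= twist_by_pure uz_antipodeM.
rewrite antipode_uKV (mulrA _ (K ^+ t)).
rewrite xm' -(mulrA _ (T _) (K ^+ t)) TidemKX -scalerAr -scalerAl.
rewrite -(mulrA _ (T _) (S _)) Tidem_antipode_Fd -scalerAr (mulrA _ (T _)).
rewrite -xm' !tpZl !scalerA (mulrA (Fd t)); congr (_ *: _).
have -> : n' - (n - p)%N%:Z - (m + p%:Z) = n' - m - n%:Z by lia.
by rewrite exprD /twist_exp !zetaD; ring.
Qed.

(** * Assembly of the formula *)

Lemma tp_suml I (s : seq I) (P : pred I) (f : I -> uz) (y : uz) :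
  (\sum_(i <- s | P i) f i) ⊗ y = \sum_(i <- s | P i) f i ⊗ y.
Proof.
pose L : {linear uz -> U2} := HB.pack (fun x : uz => x ⊗ y)
  (GRing.isLinear.Build C uz U2 *:%R _ ((tpure_bilinear uz uz).1 y)).
exact: (linear_sum L).
Qed.

Lemma tp_sumr I (s : seq I) (P : pred I) (f : I -> uz) (x : uz) :
  x ⊗ (\sum_(i <- s | P i) f i) = \sum_(i <- s | P i) x ⊗ f i.
Proof.
pose L : {linear uz -> U2} := HB.pack (fun y : uz => x ⊗ y)
  (GRing.isLinear.Build C uz U2 *:%R _ ((tpure_bilinear uz uz).2 x)).
exact: (linear_sum L).
Qed.

Section Formula.
Variables (l1 n1 l2 n2 : nat) (m1 m2 : int).
Hypotheses (n1r : (n1 < r)%N) (n2r : (n2 < r)%N).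
Local Notation D := (m1 - n1%:Z + l2%:Z - m2).

(** The summand of the theorem with the prefactor included. The integer index [b] is parametrized by
    the natural number [t = b + k2], in the form that [big_irange] produces. *)
Definition twist_term (j1 i1 k2 t i2 : nat) : U2 :=
  let b := - k2%:Z + t%:Z in
  (z ^ (2 * (D + 1) * D) * ((-1) ^ b *
       qmultinom R r (i1%:Z + j1%:Z + k2%:Z) [:: i1%:Z; j1%:Z] *
       qmultinom R r (l2%:Z + k2%:Z) [:: b - i2%:Z + k2%:Z] *
       qmultinom R r (n1%:Z - b + j1%:Z) [:: n1%:Z - i1%:Z] *
       qmultinom R r (n2%:Z + i2%:Z) [:: n2%:Z] *
       qfall R r (2 * m1 - n1%:Z + i1%:Z + j1%:Z) i1%:Z *
       qfall R r (- l2%:Z + 2 * m2 + b) (b - i2%:Z + k2%:Z) *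
       z ^ (divz ((i1%:Z + j1%:Z + k2%:Z + 3) * (i1%:Z + j1%:Z + k2%:Z)) 2
            - (i1%:Z + j1%:Z + k2%:Z - 1) * b
            + 2 * (m1 - n1%:Z + 2 * (l2%:Z - m2)) * (i1%:Z + j1%:Z)
            + 2 * (l2%:Z - m2) * k2%:Z))) *:
      ((Epow R r (l1%:Z + j1%:Z) * Tidem R r (m1 + j1%:Z) *
        Fdiv R r (n1%:Z + j1%:Z - b)) ⊗
       (Epow R r (l2%:Z - b + i2%:Z) * Tidem R r (m2 + i2%:Z) *
        Fdiv R r (n2%:Z + i2%:Z))).

Definition twist_coef n p t := (-1) ^+ (p + (n - t)) * qbin n (n - p) *
  z ^ twist_exp (m1 - n1%:Z) (m2 - l2%:Z) n p t.

Lemma twist_termE (j i k t i2 : nat) :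
    (j + i + k < r)%N -> (t <= j + i + k)%N -> (i2 <= t)%N ->
  let s := (j + i + k - t)%N in
  twist_coef (j + i + k) (j + i) t *:
  (((qbin (j + i) i * qfall R r (2 * m1 - n1%:Z + (j + i)%N%:Z) i%:Z *
     qmultinom R r (n1%:Z + s%:Z - i%:Z) [:: n1%:Z - i%:Z]) *:
    (E ^+ (l1 + j) * T (m1 + j%:Z) * Fdiv R r (n1%:Z + s%:Z - i%:Z))) ⊗
   ((qbin (l2 + k) (t - i2) *
     qfall R r (2 * m2 - l2%:Z + t%:Z - k%:Z) (t - i2)%N%:Z *
     qbin (n2 + i2) n2) *:
    (Epow R r (l2%:Z + k%:Z - t%:Z + i2%:Z) * T (m2 + i2%:Z) * Fd (n2 + i2)))) =
  twist_term j i k t i2.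
Proof.
move=> nr tn it s; rewrite tpZl tpZr !scalerA /twist_term.
have -> : - k%:Z + t%:Z - i2%:Z + k%:Z = (t - i2)%N%:Z by lia.
have -> : l2%:Z + k%:Z = (l2 + k)%N%:Z by lia.
have -> : n2%:Z + i2%:Z = (n2 + i2)%N%:Z by lia.
have -> : n1%:Z - (- k%:Z + t%:Z) + j%:Z = n1%:Z + s%:Z - i%:Z by rewrite /s; lia.
have -> : n1%:Z + j%:Z - (- k%:Z + t%:Z) = n1%:Z + s%:Z - i%:Z by rewrite /s; lia.
have -> : l2%:Z - (- k%:Z + t%:Z) + i2%:Z = (l2 + k)%N%:Z - t%:Z + i2%:Z by lia.
have -> : 2 * m1 - n1%:Z + i%:Z + j%:Z = 2 * m1 - n1%:Z + (j + i)%N%:Z by lia.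
have -> : - l2%:Z + 2 * m2 + (- k%:Z + t%:Z) = 2 * m2 - l2%:Z + t%:Z - k%:Z by lia.
rewrite qmultinom2; last by lia.
rewrite (qmultinom1 (l2 + k)); last by lia.
rewrite (qmultinom1 (n2 + i2)) // !FdivE -!idemE.
rewrite [Epow R r (l1%:Z + j%:Z)]/(E ^+ (l1 + j)).
congr (_ *: _); rewrite /twist_coef.
have -> : (i + j = j + i)%N by lia.
have -> : (j + i + k - (j + i) = k)%N by lia.
have -> : (-1) ^ (- k%:Z + t%:Z) = (-1) ^+ (j + i + (j + i + k - t)) :> C.
  have N1 : (-1 : C) != 0 by rewrite oppr_eq0 oner_eq0.
  rewrite [RHS]exprnP (_ : (j + i + (j + i + k - t))%N%:Z =
    - k%:Z + t%:Z + 2 * (j%:Z + i%:Z + k%:Z - t%:Z)); last by lia.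
  rewrite [RHS](expfzDr _ _ N1) -exprz_exp -[(-1) ^ 2]exprnP sqrrN.
  by rewrite expr1n exp1rz mulr1.
set Q1 := qmultinom _ _ _ _.
have Hz : z ^ twist_exp (m1 - n1%:Z) (m2 - l2%:Z) (j + i + k) (j + i) t =
  z ^ (2 * (D + 1) * D) *
      z ^ (divz ((i%:Z + j%:Z + k%:Z + 3) * (i%:Z + j%:Z + k%:Z)) 2
            - (i%:Z + j%:Z + k%:Z - 1) * (- k%:Z + t%:Z)
            + 2 * (m1 - n1%:Z + 2 * (l2%:Z - m2)) * (i%:Z + j%:Z)
            + 2 * (l2%:Z - m2) * k%:Z).
  rewrite -zetaD; congr (z ^ _).
  (* With [N = i + j + k], [(N + 3) * N] is twice ['C(N, 2) + 2 * N], so the integer division is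
     exact. *)
  have -> : divz ((i%:Z + j%:Z + k%:Z + 3) * (i%:Z + j%:Z + k%:Z)) 2 =
      'C(j + i + k, 2)%:Z + 2 * (j + i + k)%N%:Z.
    have := bin2_double (j + i + k) => Hb.
    rewrite (_ : _ * _ = ('C(j + i + k, 2)%:Z + 2 * (j + i + k)%N%:Z) * 2).
      by rewrite mulzK.
    by lia.
  rewrite /twist_exp.
  have -> : (j + i + k - (j + i))%N%:Z = k%:Z by lia.
  have -> : (j + i + k - t)%N%:Z = j%:Z + i%:Z + k%:Z - t%:Z by lia.
  have -> : (j + i)%N%:Z = j%:Z + i%:Z by [].
  have -> : (j + i + k)%N%:Z = j%:Z + i%:Z + k%:Z by [].
  by ring.
rewrite Hz; ring.
Qed.

Lemma rho2_twist_nat :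
  rho2_twist ((E ^+ l1 * T m1 * Fd n1) ⊗ (E ^+ l2 * T m2 * Fd n2)) =
  \sum_(j < r) \sum_(i < r - j) \sum_(k < r - j - i) \sum_(t < (j + i + k).+1)
    \sum_(i2 < t.+1) twist_term j i k t i2.
Proof.
set x := E ^+ l1 * _ * _; set y := E ^+ l2 * _ * _.
have TT m : T m * T m = T m by rewrite Tidem_mul subrr dvdz0 scale1r.
have xm : x = x * T (m1 - n1%:Z).
  rewrite /x -(mulrA _ (Fd n1)) -TidemFd (mulrA _ (T m1)).
  by rewrite -(mulrA _ (T m1) (T m1)) TT.
have yn : y = T (m2 - l2%:Z) * y.
  by rewrite /y !mulrA TidemEX subrK -(mulrA _ (T m2) (T m2)) TT.
rewrite (rho2_twist_expansion xm yn).
(* Two uses of [sum_triangle] change the indices: [n = p + k] frees [p] and [k], and [p = j + i]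
   splits the power of [E] in the first factor. *)
pose G k p := \sum_(t < (p + k).+1) twist_coef (p + k) p t *:
    ((x * E ^+ p * Fd (p + k - t)) ⊗ (Fd t * E ^+ k * y)).
transitivity (\sum_(n < r) \sum_(p < n.+1) G (n - p)%N p).
  apply: eq_bigr => n _; apply: eq_bigr => p _.
  by rewrite /G subnKC // -ltnS.
rewrite (sum_triangle _ (fun p k => G k p)).
pose H j i := \sum_(k < r - (j + i)) \sum_(t < (j + i + k).+1)
    \sum_(i2 < t.+1) twist_term j i k t i2.
transitivity (\sum_(p < r) \sum_(j < p.+1) H j (p - j)%N); last first.
  rewrite sum_triangle; apply: eq_bigr => j _.
  by apply: eq_bigr => i _; rewrite /H subnDA.
apply: eq_bigr => [[p pr] _] /=.
transitivity (\sum_(j < p.+1) \sum_(k < r - p) \sum_(t < (p + k).+1)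
    \sum_(i2 < t.+1) twist_term j (p - j) k t i2); last first.
  by apply: eq_bigr => [[j /= jp] _]; rewrite /H subnKC.
rewrite exchange_big /=; apply: eq_bigr => [[k /= kr] _].
rewrite exchange_big /=; apply: eq_bigr => [[t /= tp] _].
rewrite left_factor; try by lia.
rewrite right_factor; try by lia.
rewrite tp_suml scaler_sumr; apply: eq_bigr => [[j /= jp] _].
rewrite tp_sumr scaler_sumr; apply: eq_bigr => [[i2 /= it] _].
rewrite -twist_termE; try by lia.
by rewrite subnKC.
Qed.
End Formula.

End SmallQuantumGroup.

Theorem lemma5p5 (R : realType) (r : nat) (r_ge3 : (3 <= r)%N) (r_odd : odd r) :
  let L := OddLevel r_ge3 r_odd in
  let z := zeta R r in
  let E := Epow R L in
  let T := Tidem R L in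
  let F := Fdiv R L in
  let mult := qmultinom R L in
  let brace := qfall R L in
  exists2 c : R[i], c != 0 &
  forall l1 m1 n1 l2 m2 n2 : int,
    0 <= l1 <= r%:Z - 1 -> 0 <= m1 <= r%:Z - 1 -> 0 <= n1 <= r%:Z - 1 ->
    0 <= l2 <= r%:Z - 1 -> 0 <= m2 <= r%:Z - 1 -> 0 <= n2 <= r%:Z - 1 ->
  rho2_twist ((E l1 * T m1 * F n1) ⊗ (E l2 * T m2 * F n2)) =
  c *: (z ^ (2 * (m1 - n1 + l2 - m2 + 1) * (m1 - n1 + l2 - m2)) *:
    \sum_(j1 <- irange 0 (r%:Z - 1))
    \sum_(i1 <- irange 0 (r%:Z - j1 - 1))
    \sum_(k2 <- irange 0 (r%:Z - i1 - j1 - 1))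
    \sum_(b <- irange (- k2) (i1 + j1))
    \sum_(i2 <- irange 0 (b + k2))
      ((-1) ^ b *
       mult (i1 + j1 + k2) [:: i1; j1] *
       mult (l2 + k2) [:: b - i2 + k2] *
       mult (n1 - b + j1) [:: n1 - i1] *
       mult (n2 + i2) [:: n2] *
       brace (2 * m1 - n1 + i1 + j1) i1 *
       brace (- l2 + 2 * m2 + b) (b - i2 + k2) *
       z ^ (divz ((i1 + j1 + k2 + 3) * (i1 + j1 + k2)) 2
            - (i1 + j1 + k2 - 1) * b
            + 2 * (m1 - n1 + 2 * (l2 - m2)) * (i1 + j1)
            + 2 * (l2 - m2) * k2)) *:
      ((E (l1 + j1) * T (m1 + j1) * F (n1 + j1 - b)) ⊗
       (E (l2 - b + i2) * T (m2 + i2) * F (n2 + i2)))).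
Proof.
(* The two sides agree exactly, so the scalar is 1. *)
move=> L z E T F mult brace; exists 1; first exact: oner_neq0.
case=> // l1 m1 [] // n1 [] // l2 m2 [] // n2 _ _ n1r _ _ n2r; rewrite scale1r.
have n1L : (n1 < L)%N by move: n1r; rewrite /=; lia.
have n2L : (n2 < L)%N by move: n2r; rewrite /=; lia.
have := rho2_twist_nat R l1 l2 m1 m2 n1L n2L.
rewrite !idemE -!FdivE => ->.
rewrite (@big_irange _ _ _ _ _ r) ?add0r // scaler_sumr.
apply: eq_bigr => [[j /= jr] _]; rewrite !add0r.
rewrite (@big_irange _ _ _ _ _ (r - j)); last by lia.
rewrite scaler_sumr; apply: eq_bigr => [[i /= ir] _]; rewrite !add0r.
rewrite (@big_irange _ _ _ _ _ (r - j - i)); last by lia.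
rewrite scaler_sumr; apply: eq_bigr => [[k /= kr] _]; rewrite !add0r.
rewrite (@big_irange _ _ _ _ _ (j + i + k).+1); last by lia.
rewrite scaler_sumr; apply: eq_bigr => [[t /= tr] _].
rewrite (@big_irange _ _ _ _ _ t.+1); last by lia.
rewrite scaler_sumr; apply: eq_bigr => [[i2 /= i2t] _]; rewrite !add0r.
by rewrite scalerA.
Qed.
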